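(* Let $k$ be a field, $\mathfrak S$ a $k$-linear Grothendieck category, $H$ a Hopf algebra over $k$, $A$ a right $H$-comodule algebra, and let $(\mathcal M,\mu_{\mathcal M}^A,\Delta_{\mathcal M}^H)\in{}_A\mathfrak S^H$. Then $\mathcal M$ determines a functor $\mathcal M\otimes-:\mathrm{Com}\text{-}H\to{}_A\mathfrak S^H$ that has a right adjoint ${}_{{}_A\mathfrak S}HOM(\mathcal M,-):{}_A\mathfrak S^H\to\mathrm{Com}\text{-}H$. In other words, there are natural isomorphisms $${}_A\mathfrak S^H(\mathcal M\otimes N,\mathcal P)\cong \mathrm{Com}\text{-}H\big(N,{}_{{}_A\mathfrak S}HOM(\mathcal M,\mathcal P)\big)$$ for $\mathcal P\in{}_A\mathfrak S^H$ and $N\in\mathrm{Com}\text{-}H$.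
   Context: Write $\otimes=\otimes_k$. For $\mathcal M\in\mathfrak S$ and a $k$-vector space $V$, $\mathcal M\otimes V\in\mathfrak S$ is defined by letting $\mathcal M\otimes-:k\text{-Mod}\to\mathfrak S$ be the left adjoint of $\mathfrak S(\mathcal M,-)$; we identify $V\otimes\mathcal M$ with $\mathcal M\otimes V$, and $T$ denotes such swap isomorphisms. $\mathrm{Com}\text{-}H$ is the category of right $H$-comodules. ${}_A\mathfrak S^H$ is the category of left-right relative $(A,H)$-Hopf module objects in $\mathfrak S$: triples $(\mathcal M,\mu_{\mathcal M}^A,\Delta_{\mathcal M}^H)$ where $\mu_{\mathcal M}^A:A\otimes\mathcal M\to\mathcal M$ is a (unital, associative) left $A$-module structure on $\mathcal M\in\mathfrak S$, $\Delta_{\mathcal M}^H:\mathcal M\to\mathcal M\otimes H$ is a (counital, coassociative) right $H$-comodule structure, and $\Delta^H_{\mathcal M}\circ\mu^A_{\mathcal M}=(\mu^A_{\mathcal M}\otimes\mu_H)\circ(A\otimes T_{H,\mathcal M}\otimes H)\circ(\Delta_A^H\otimes\Delta^H_{\mathcal M})$. Morphisms are morphisms in $\mathfrak S$ compatible with the $A$-action and $H$-coaction. For $N\in\mathrm{Com}\text{-}H$ with coaction $\Delta_N$, $\mathcal M\otimes N$ carries the left $A$-action $\mu_{\mathcal M}^A\otimes N$ and the right $H$-coaction $$\mathcal M\otimes N\xrightarrow{\Delta_{\mathcal M}^H\otimes\Delta_N}\mathcal M\otimes H\otimes N\otimes H\xrightarrow{\mathcal M\otimes T_{H,N}\otimes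 H}\mathcal M\otimes N\otimes H\otimes H\xrightarrow{\mathcal M\otimes N\otimes\mu_H}\mathcal M\otimes N\otimes H.$$ *)

(* Defs.v *)
From HB Require Import structures.
From mathcomp Require Import all_boot all_algebra.
From mathcomp Require Import boolp.

Set Implicit Arguments.
Unset Strict Implicit.
Unset Printing Implicit Defensive.

Import GRing.Theory.
Local Open Scope ring_scope.
Local Open Scope quotient_scope.

Reserved Notation "V ⊗ W" (at level 40, left associativity).
Reserved Notation "v ⊙ w" (at level 40, left associativity).
Reserved Notation "M ⊠ V" (at level 40, left associativity).
Reserved Notation "g ∘ f" (at level 40, left associativity).

Notation is_bilinear b := (bilinear_for *:%R *:%R b).

Section LinearMaps.
Variable k : fieldType.

Lemma linear_ext (V W : lmodType k) (f g : {linear V -> W}) : f =1 g -> f = g.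
Proof.
case: f g => [f [[fa] [fs]]] [g [[ga] [gs]]] /= /funext fg.
by subst g; congr (GRing.Linear.Pack (GRing.Linear.Class _ _));
  congr (_ _); apply: Prop_irrelevance.
Qed.

Definition linear_of (V W : lmodType k) (f : V -> W) (hf : linear f) :
    {linear V -> W} :=
  HB.pack f (GRing.isLinear.Build k V W *:%R f hf).

Lemma linear_ofE (V W : lmodType k) (f : V -> W) (hf : linear f) v :
  linear_of hf v = f v.
Proof. by []. Qed.

Lemma linear_comp (U V W : lmodType k) (g : {linear V -> W})
    (f : {linear U -> V}) : linear (g \o f).
Proof. by move=> a u v /=; rewrite !linearP. Qed.

End LinearMaps.

(* V ⊗ W is the set of formal sums of pairs (v, w), two sums being identified *)
(* when every bilinear map takes the same value on them.                      *)
Section TensorType.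
Variables (k : fieldType) (V W : lmodType k).

Definition formal_sum := seq (V * W).
HB.instance Definition _ := Choice.on formal_sum.

Definition formal_eval (U : lmodType k) (b : V -> W -> U) (s : formal_sum) : U :=
  \sum_(p <- s) b p.1 p.2.

Definition tensor_rel (s t : formal_sum) : bool :=
  `[< forall (U : lmodType k) (b : V -> W -> U), is_bilinear b ->
        formal_eval b s = formal_eval b t >].

Lemma tensor_rel_refl : reflexive tensor_rel.
Proof. by move=> s; apply/asboolP. Qed.

Lemma tensor_rel_sym : symmetric tensor_rel.
Proof. by move=> s t; apply/asboolP/asboolP => h U b hb; rewrite h. Qed.

Lemma tensor_rel_trans : transitive tensor_rel.
Proof.
move=> s t u /asboolP h /asboolP h'; apply/asboolP => U b hb.
by rewrite h // h'.
Qed.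

Canonical tensor_equiv :=
  EquivRel tensor_rel tensor_rel_refl tensor_rel_sym tensor_rel_trans.

Definition tensor_type := {eq_quot tensor_equiv}.
HB.instance Definition _ := Choice.on tensor_type.
HB.instance Definition _ := EqQuotient.on tensor_type.

Definition tlift (U : lmodType k) (b : V -> W -> U) (t : tensor_type) : U :=
  formal_eval b (repr t).

Definition pure (v : V) (w : W) : tensor_type := \pi_tensor_type [:: (v, w)].
Definition tens0 : tensor_type := \pi_tensor_type [::].
Definition tensD (s t : tensor_type) : tensor_type := \pi_tensor_type (repr s ++ repr t).
Definition tensZ (a : k) (t : tensor_type) : tensor_type :=
  \pi_tensor_type [seq (a *: p.1, p.2) | p <- repr t].

Lemma tlift_pi (U : lmodType k) (b : V -> W -> U) (s : formal_sum) :
  is_bilinear b -> tlift b (\pi_tensor_type s) = formal_eval b s.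
Proof.
move=> hb; rewrite /tlift.
have /eqmodP/asboolP -> // : repr (\pi_tensor_type s) = s %[mod_eq tensor_equiv].
by rewrite reprK.
Qed.

Lemma tensor_eq (s t : tensor_type) :
    (forall (U : lmodType k) (b : V -> W -> U), is_bilinear b ->
       tlift b s = tlift b t) -> s = t.
Proof.
move=> h; rewrite -[s]reprK -[t]reprK; apply/eqmodP/asboolP => U b hb.
exact: h.
Qed.

Section Lift.
Variables (U : lmodType k) (b : V -> W -> U) (hb : is_bilinear b).

Lemma bilinear0l w : b 0 w = 0.
Proof. exact: (linear0 (linear_of (hb.1 w))). Qed.

Lemma bilinearZl a v w : b (a *: v) w = a *: b v w.
Proof. exact: (linearZ_LR (linear_of (hb.1 w))). Qed.

Lemma tlift_pure v w : tlift b (pure v w) = b v w.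
Proof. by rewrite tlift_pi // /formal_eval big_seq1. Qed.

Lemma tlift0 : tlift b tens0 = 0.
Proof. by rewrite tlift_pi // /formal_eval big_nil. Qed.

Lemma tliftD s t :
  tlift b (tensD s t) = tlift b s + tlift b t.
Proof. by rewrite tlift_pi // /formal_eval big_cat. Qed.

Lemma tliftZ a t : tlift b (tensZ a t) = a *: tlift b t.
Proof.
rewrite tlift_pi // /tlift /formal_eval big_map scaler_sumr.
by apply: eq_bigr => p _ /=; rewrite bilinearZl.
Qed.

End Lift.

Lemma tensDA : associative tensD.
Proof. by move=> s t u; apply: tensor_eq => U b hb; rewrite !tliftD // addrA. Qed.

Lemma tensDC : commutative tensD.
Proof. by move=> s t; apply: tensor_eq => U b hb; rewrite !tliftD // addrC. Qed.

Lemma tens0D : left_id tens0 tensD.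
Proof.
by move=> s; apply: tensor_eq => U b hb; rewrite !tliftD // tlift0 // add0r.
Qed.

Lemma tensND : left_inverse tens0 (tensZ (- 1)) tensD.
Proof.
move=> s; apply: tensor_eq => U b hb.
by rewrite tliftD // tliftZ // tlift0 // scaleN1r addNr.
Qed.

HB.instance Definition _ :=
  GRing.isZmodule.Build tensor_type tensDA tensDC tens0D tensND.

Lemma tensZA a b (t : tensor_type) : tensZ a (tensZ b t) = tensZ (a * b) t.
Proof. by apply: tensor_eq => U c hc; rewrite !tliftZ // scalerA. Qed.

Lemma tens1Z : left_id 1 tensZ.
Proof. by move=> t; apply: tensor_eq => U c hc; rewrite tliftZ // scale1r. Qed.

Lemma tensZDr : right_distributive tensZ +%R.
Proof.
move=> a s t; apply: tensor_eq => U c hc.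
by rewrite tliftZ // !tliftD // scalerDr !tliftZ.
Qed.

Lemma tensZDl (t : tensor_type) : {morph tensZ^~ t : a b / a + b}.
Proof.
move=> a b; apply: tensor_eq => U c hc.
by rewrite tliftD // !tliftZ // scalerDl.
Qed.

HB.instance Definition _ :=
  GRing.Zmodule_isLmodule.Build k tensor_type tensZA tens1Z tensZDr tensZDl.

End TensorType.

Section Tensor.
Variables (k : fieldType) (V W : lmodType k).

Definition tensor : lmodType k := GRing.Lmodule.clone k (tensor_type V W) _.

Definition tens (v : V) (w : W) : tensor := pure v w.

Definition tensor_lift (U : lmodType k) (b : V -> W -> U) (t : tensor) : U :=
  tlift b t.

Lemma tensor_lift_tens (U : lmodType k) (b : V -> W -> U) v w :
  is_bilinear b -> tensor_lift b (tens v w) = b v w.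
Proof. by move=> hb; apply: tlift_pure. Qed.

Lemma tensor_ext (s t : tensor) :
    (forall (U : lmodType k) (b : V -> W -> U), is_bilinear b ->
       tensor_lift b s = tensor_lift b t) -> s = t.
Proof. exact: tensor_eq. Qed.

Lemma tensor_lift_linear (U : lmodType k) (b : V -> W -> U) :
  is_bilinear b -> linear (tensor_lift b).
Proof. by move=> hb a s t; rewrite /tensor_lift tliftD // tliftZ. Qed.

Lemma tens_bilinear : is_bilinear tens.
Proof.
split=> [w a u v | v a u w]; apply: tensor_ext => U b hb;
  rewrite tensor_lift_linear // !tensor_lift_tens //; [exact: hb.1 | exact: hb.2].
Qed.

Lemma tensPl a u v w : tens (a *: u + v) w = a *: tens u w + tens v w.
Proof. exact: tens_bilinear.1. Qed.

Lemma tensPr a v u w : tens v (a *: u + w) = a *: tens v u + tens v w.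
Proof. exact: tens_bilinear.2. Qed.

Lemma tensor_lift_param (Z U : lmodType k) (b : Z -> V -> W -> U) :
    (forall v w, linear (fun z => b z v w)) ->
  forall t, linear (fun z => tensor_lift (b z) t).
Proof.
move=> hb t a x y; rewrite /tensor_lift /tlift /formal_eval scaler_sumr -big_split /=.
by apply: eq_bigr => p _; rewrite hb.
Qed.

Lemma tensor_ind_eq (U : lmodType k) (f g : tensor -> U) :
    linear f -> linear g -> (forall v w, f (tens v w) = g (tens v w)) -> f =1 g.
Proof.
move=> hf hg e t.
suff h (h' : tensor -> U) : linear h' -> h' t = tensor_lift (fun v w => h' (tens v w)) t.
  rewrite (h _ hf) (h _ hg) /tensor_lift /tlift /formal_eval.
  by apply: eq_bigr => p _; rewrite e.
move=> hh; pose l := linear_of hh.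
have hb : is_bilinear (fun v w => h' (tens v w)).
  by split=> [w a u v | v a u w]; rewrite ?tensPl ?tensPr hh.
have -> : t = \sum_(p <- repr (t : tensor_type V W)) tens p.1 p.2.
  apply: tensor_ext => X b hX.
  rewrite -[RHS]/(linear_of (tensor_lift_linear hX) _) linear_sum /=.
  by apply: eq_bigr => p _; rewrite tensor_lift_tens.
rewrite -[LHS]/(l _) linear_sum.
rewrite -[RHS]/(linear_of (tensor_lift_linear hb) _) linear_sum.
by apply: eq_bigr => p _ /=; rewrite tensor_lift_tens.
Qed.

End Tensor.

Arguments tensor : simpl never.
Notation "V ⊗ W" := (tensor V W).
Notation "v ⊙ w" := (tens v w) : ring_scope.

Section TensorMaps.
Variable k : fieldType.
Implicit Types U V W X : lmodType k.

Lemma tmap_bilinear V V' W W' (f : {linear V -> V'}) (g : {linear W -> W'}) :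
  is_bilinear (fun v w => f v ⊙ g w).
Proof.
by split=> [w a u v | v a u w] /=; rewrite linearP ?tensPl ?tensPr.
Qed.

Definition tmap V V' W W' (f : {linear V -> V'}) (g : {linear W -> W'}) : V ⊗ W -> V' ⊗ W' :=
  tensor_lift (fun v w => f v ⊙ g w).
HB.instance Definition _ V V' W W' (f : {linear V -> V'}) (g : {linear W -> W'}) :=
  GRing.isLinear.Build k _ _ _ (tmap f g)
    (tensor_lift_linear (tmap_bilinear f g)).

Lemma tswap_bilinear V W : is_bilinear (fun (v : V) (w : W) => w ⊙ v).
Proof.
by split=> [w a u v | v a u w]; rewrite ?tensPl ?tensPr.
Qed.

Definition tswap V W : V ⊗ W -> W ⊗ V :=
  tensor_lift (fun v w => w ⊙ v).
HB.instance Definition _ V W :=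
  GRing.isLinear.Build k _ _ _ (@tswap V W)
    (tensor_lift_linear (@tswap_bilinear V W)).

Lemma tassoc_bilinear1 U V W (w : W) :
  is_bilinear (fun (u : U) (v : V) => u ⊙ (v ⊙ w)).
Proof.
by split=> [v a x y | u a x y]; rewrite ?tensPl ?tensPr.
Qed.

Lemma tassoc_bilinear U V W :
  is_bilinear (fun (p : U ⊗ V) (w : W) =>
    tensor_lift (fun u v => u ⊙ (v ⊙ w)) p).
Proof.
split=> [w | p]; first exact: (tensor_lift_linear (@tassoc_bilinear1 U V W w)).
apply: (@tensor_lift_param _ _ _ _ _ (fun w u v => u ⊙ (v ⊙ w))) => u v a x y.
by rewrite !tensPr.
Qed.

Definition tassoc U V W : (U ⊗ V) ⊗ W -> U ⊗ (V ⊗ W) :=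
  tensor_lift (fun p w => tensor_lift (fun u v => u ⊙ (v ⊙ w)) p).
HB.instance Definition _ U V W :=
  GRing.isLinear.Build k _ _ _ (@tassoc U V W)
    (tensor_lift_linear (@tassoc_bilinear U V W)).

Lemma tunitr_bilinear V : is_bilinear (fun (v : V) (a : k^o) => a *: v).
Proof.
split=> [a c u v | v c a b] /=; first by rewrite scalerDr !scalerA mulrC.
by rewrite scalerDl scalerA.
Qed.

Definition tunitr V : V ⊗ k^o -> V :=
  tensor_lift (fun (v : V) (a : k^o) => a *: v).
HB.instance Definition _ V :=
  GRing.isLinear.Build k _ _ _ (@tunitr V)
    (tensor_lift_linear (@tunitr_bilinear V)).

Lemma tmid_bilinear1 U V W X (u : U) (v : V) :
  is_bilinear (fun (w : W) (x : X) => (u ⊙ w) ⊙ (v ⊙ x)).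
Proof.
split=> [x a w w' | w a x x']; first by rewrite tensPr tensPl.
by rewrite !tensPr.
Qed.

Lemma tmid_bilinear2 U V W X (q : W ⊗ X) :
  is_bilinear (fun (u : U) (v : V) =>
    tensor_lift (fun w x => (u ⊙ w) ⊙ (v ⊙ x)) q).
Proof.
split=> [v | u].
  apply: (@tensor_lift_param _ _ _ _ _ (fun u w x => (u ⊙ w) ⊙ (v ⊙ x))).
  by move=> w x a y z; rewrite !tensPl.
apply: (@tensor_lift_param _ _ _ _ _ (fun v w x => (u ⊙ w) ⊙ (v ⊙ x))).
by move=> w x a y z; rewrite tensPl tensPr.
Qed.

Lemma tmid_bilinear U V W X :
  is_bilinear (fun (p : U ⊗ V) (q : W ⊗ X) =>
    tensor_lift (fun u v => tensor_lift (fun w x => (u ⊙ w) ⊙ (v ⊙ x)) q) p).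
Proof.
split=> [q | p]; first exact: (tensor_lift_linear (@tmid_bilinear2 U V W X q)).
apply: (@tensor_lift_param _ _ _ _ _ (fun q u v =>
  tensor_lift (fun w x => (u ⊙ w) ⊙ (v ⊙ x)) q)) => u v.
exact: (tensor_lift_linear (@tmid_bilinear1 U V W X u v)).
Qed.

Definition tmid U V W X : (U ⊗ V) ⊗ (W ⊗ X) -> (U ⊗ W) ⊗ (V ⊗ X) :=
  tensor_lift (fun p q =>
    tensor_lift (fun u v => tensor_lift (fun w x => (u ⊙ w) ⊙ (v ⊙ x)) q) p).
HB.instance Definition _ U V W X :=
  GRing.isLinear.Build k _ _ _ (@tmid U V W X)
    (tensor_lift_linear (@tmid_bilinear U V W X)).

Lemma tmapE V V' W W' (f : {linear V -> V'}) (g : {linear W -> W'}) v w :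
  tmap f g (v ⊙ w) = f v ⊙ g w.
Proof. exact: (tensor_lift_tens _ _ (tmap_bilinear f g)). Qed.

Lemma tswapE V W (v : V) (w : W) : tswap (v ⊙ w) = w ⊙ v.
Proof. exact: (tensor_lift_tens _ _ (@tswap_bilinear V W)). Qed.

Lemma tassocE U V W (u : U) (v : V) (w : W) :
  tassoc ((u ⊙ v) ⊙ w) = u ⊙ (v ⊙ w).
Proof.
rewrite [LHS](tensor_lift_tens _ _ (@tassoc_bilinear U V W)).
exact: (tensor_lift_tens _ _ (@tassoc_bilinear1 U V W w)).
Qed.

Lemma tunitrE V (v : V) (a : k^o) : tunitr (v ⊙ a) = a *: v.
Proof. exact: (tensor_lift_tens _ _ (@tunitr_bilinear V)). Qed.

Lemma tmidE U V W X (u : U) (v : V) (w : W) (x : X) :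
  tmid ((u ⊙ v) ⊙ (w ⊙ x)) = (u ⊙ w) ⊙ (v ⊙ x).
Proof.
rewrite [LHS](tensor_lift_tens _ _ (@tmid_bilinear U V W X)).
rewrite [LHS](tensor_lift_tens _ _ (@tmid_bilinear2 U V W X (w ⊙ x))).
exact: (tensor_lift_tens _ _ (@tmid_bilinear1 U V W X u v)).
Qed.

Lemma tmap_idfun (V W : lmodType k) (t : V ⊗ W) : tmap idfun idfun t = t.
Proof.
apply: (tensor_ind_eq (f := tmap idfun idfun) (g := id)) => //.
  exact: linearP.
by move=> v w; rewrite tmapE.
Qed.

Lemma tmap_comp (V V' V'' W W' W'' : lmodType k) (f : {linear V -> V'})
    (f' : {linear V' -> V''}) (g : {linear W -> W'}) (g' : {linear W' -> W''})
    (f'' : {linear V -> V''}) (g'' : {linear W -> W''}) t :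
  f'' =1 f' \o f -> g'' =1 g' \o g ->
  tmap f'' g'' t = tmap f' g' (tmap f g t).
Proof.
move=> ff gg.
apply: (tensor_ind_eq (f := tmap f'' g'') (g := tmap f' g' \o tmap f g))
  => [||v w].
- exact: linearP.
- by move=> a x y /=; rewrite !linearP.
- by rewrite [RHS]/= !tmapE ff gg.
Qed.

End TensorMaps.


(* A structure of our own because algType excludes the zero algebra. *)
Record algebra (k : fieldType) := Algebra {
  alg_sort :> lmodType k;
  alg_mul : {linear alg_sort ⊗ alg_sort -> alg_sort};
  alg_one : alg_sort;
  alg_mulA : forall a b c, alg_mul (alg_mul (a ⊙ b) ⊙ c) = alg_mul (a ⊙ alg_mul (b ⊙ c));
  alg_mul1l : forall a, alg_mul (alg_one ⊙ a) = a;
  alg_mul1r : forall a, alg_mul (a ⊙ alg_one) = a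
}.
Arguments alg_mul {k} A : rename.
Arguments alg_one {k} A : rename.

Record hopf_algebra (k : fieldType) := HopfAlgebra {
  hopf_alg :> algebra k;
  comul : {linear hopf_alg -> hopf_alg ⊗ hopf_alg};
  counit : {linear hopf_alg -> k^o};
  antipode : {linear hopf_alg -> hopf_alg};
  comulA : forall h,
    tassoc (tmap comul idfun (comul h)) = tmap idfun comul (comul h);
  counitl : forall h, tunitr (tswap (tmap counit idfun (comul h))) = h;
  counitr : forall h, tunitr (tmap idfun counit (comul h)) = h;
  comulM : forall t, comul (alg_mul hopf_alg t) =
    tmap (alg_mul hopf_alg) (alg_mul hopf_alg) (tmid (tmap comul comul t));
  comul1 : comul (alg_one hopf_alg) = alg_one hopf_alg ⊙ alg_one hopf_alg;
  counitM : forall g h, counit (alg_mul hopf_alg (g ⊙ h)) = counit g * counit h;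
  counit1 : counit (alg_one hopf_alg) = 1;
  antipodel : forall h,
    alg_mul hopf_alg (tmap antipode idfun (comul h)) = counit h *: alg_one hopf_alg;
  antipoder : forall h,
    alg_mul hopf_alg (tmap idfun antipode (comul h)) = counit h *: alg_one hopf_alg
}.
Arguments comul {k} H : rename.
Arguments counit {k} H : rename.
Arguments antipode {k} H : rename.

Definition is_coaction (k : fieldType) (H : hopf_algebra k) (N : lmodType k)
    (rho : {linear N -> N ⊗ H}) : Prop :=
  (forall n, tassoc (tmap rho idfun (rho n)) = tmap idfun (comul H) (rho n))
  /\ (forall n, tunitr (tmap idfun (counit H) (rho n)) = n).

Record comodule (k : fieldType) (H : hopf_algebra k) := Comodule {
  com_sort :> lmodType k;
  com_coact : {linear com_sort -> com_sort ⊗ H};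
  com_coactP : is_coaction com_coact
}.

Record comodule_algebra (k : fieldType) (H : hopf_algebra k) := ComoduleAlgebra {
  ca_alg :> algebra k;
  ca_coact : {linear ca_alg -> ca_alg ⊗ H};
  ca_coactP : is_coaction ca_coact;
  ca_coactM : forall t, ca_coact (alg_mul ca_alg t) =
    tmap (alg_mul ca_alg) (alg_mul H) (tmid (tmap ca_coact ca_coact t));
  ca_coact1 : ca_coact (alg_one ca_alg) = alg_one ca_alg ⊙ alg_one H
}.

Record category := Category {
  ob :> Type;
  hom : ob -> ob -> Type;
  idm : forall X, hom X X;
  ccomp : forall X Y Z, hom Y Z -> hom X Y -> hom X Z;
  compA : forall X Y Z T (h : hom Z T) (g : hom Y Z) (f : hom X Y),
    ccomp h (ccomp g f) = ccomp (ccomp h g) f;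
  comp1l : forall X Y (f : hom X Y), ccomp (idm Y) f = f;
  comp1r : forall X Y (f : hom X Y), ccomp f (idm X) = f
}.
Arguments hom {c} X Y.
Arguments idm {c} X.
Arguments ccomp {c X Y Z} g f.

Record functor (C D : category) := Functor {
  fob :> C -> D;
  fmap : forall X Y, hom X Y -> hom (fob X) (fob Y);
  fmap1 : forall X, fmap (idm X) = idm (fob X);
  fmapM : forall X Y Z (g : hom Y Z) (f : hom X Y),
    fmap (ccomp g f) = ccomp (fmap g) (fmap f)
}.
Arguments fmap {C D} F {X Y} f : rename.

Record adjunction (C D : category) (F : functor C D) (G : functor D C) :=
  Adjunction {
  adj : forall X Y, hom (F X) Y -> hom X (G Y);
  adj_bij : forall X Y, bijective (@adj X Y);
  adj_natl : forall X X' Y (f : hom X' X) (g : hom (F X) Y),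
    adj (ccomp g (fmap F f)) = ccomp (adj g) f;
  adj_natr : forall X Y Y' (g : hom (F X) Y) (h : hom Y Y'),
    adj (ccomp h g) = ccomp (fmap G h) (adj g)
}.

Section VectCategory.
Variable k : fieldType.

Definition vect_comp (U V W : lmodType k) (g : {linear V -> W})
    (f : {linear U -> V}) : {linear U -> W} := g \o f.

Definition vect : category.
Proof.
refine (@Category (lmodType k) (fun V W => {linear V -> W}) (fun V => idfun)
  vect_comp _ _ _) => *; exact: linear_ext.
Defined.

End VectCategory.

Section ComoduleCategory.
Variables (k : fieldType) (H : hopf_algebra k).

Definition is_colinear (N N' : comodule H) (f : {linear N -> N'}) : Prop :=
  forall n, com_coact N' (f n) = tmap f idfun (com_coact N n).

Definition comod_hom (N N' : comodule H) :=
  {f : {linear N -> N'} | is_colinear f}.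

Lemma comod_id_subproof (N : comodule H) : @is_colinear N N idfun.
Proof. by move=> n; rewrite tmap_idfun. Qed.

Lemma comod_comp_subproof (N N' N'' : comodule H) (g : comod_hom N' N'')
    (f : comod_hom N N') : is_colinear (vect_comp (sval g) (sval f)).
Proof.
move=> n; rewrite /= (svalP g) (svalP f).
by rewrite (tmap_comp (f := sval f) (f' := sval g) (g := idfun) (g' := idfun)).
Qed.

Lemma comod_hom_ext (N N' : comodule H) (f g : comod_hom N N') :
  sval f = sval g -> f = g.
Proof. by case: f g => f hf [g hg] /= e; subst g; congr exist. Qed.

Definition Com : category.
Proof.
refine (@Category (comodule H) comod_hom
  (fun N => exist _ _ (@comod_id_subproof N))
  (fun N N' N'' g f => exist _ _ (comod_comp_subproof g f)) _ _ _)
  => *; apply: comod_hom_ext; exact: linear_ext.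
Defined.

End ComoduleCategory.

Record klincat (k : fieldType) := KLinCat {
  kob :> Type;
  khom : kob -> kob -> lmodType k;
  kid : forall X, khom X X;
  kcomp : forall X Y Z, khom Y Z -> khom X Y -> khom X Z;
  kcompA : forall X Y Z T (h : khom Z T) (g : khom Y Z) (f : khom X Y),
    kcomp h (kcomp g f) = kcomp (kcomp h g) f;
  kcomp1l : forall X Y (f : khom X Y), kcomp (kid Y) f = f;
  kcomp1r : forall X Y (f : khom X Y), kcomp f (kid X) = f;
  kcomp_bilinear : forall X Y Z, is_bilinear (@kcomp X Y Z)
}.
Arguments khom {k S} X Y : rename.
Arguments kid {k S} X : rename.
Arguments kcomp {k S X Y Z} g f : rename.

Notation "g ∘ f" := (kcomp g f) : ring_scope.

Section GrothendieckAxioms.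
Variables (k : fieldType) (S : klincat k).

Definition underlying_category : category :=
  @Category S (fun X Y => khom X Y) (fun X => kid X)
    (fun X Y Z g f => g ∘ f) (@kcompA _ S) (@kcomp1l _ S) (@kcomp1r _ S).

Definition is_mono (X Y : S) (f : khom X Y) : Prop :=
  forall Z (g h : khom Z X), f ∘ g = f ∘ h -> g = h.

Definition is_epi (X Y : S) (f : khom X Y) : Prop :=
  forall Z (g h : khom Y Z), g ∘ f = h ∘ f -> g = h.

Definition is_zero_object (Z : S) : Prop :=
  forall X, (forall f : khom Z X, f = 0) /\ (forall f : khom X Z, f = 0).

Definition is_biproduct (X Y B : S) : Prop :=
  exists (i : khom X B) (j : khom Y B) (p : khom B X) (q : khom B Y),
    [/\ p ∘ i = kid X, q ∘ j = kid Y, p ∘ j = 0, q ∘ i = 0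
      & i ∘ p + j ∘ q = kid B].

Definition is_kernel (X Y K : S) (f : khom X Y) (i : khom K X) : Prop :=
  f ∘ i = 0 /\
  forall Z (g : khom Z X), f ∘ g = 0 -> exists! h : khom Z K, i ∘ h = g.

Definition is_cokernel (X Y Q : S) (f : khom X Y) (p : khom Y Q) : Prop :=
  p ∘ f = 0 /\
  forall Z (g : khom Y Z), g ∘ f = 0 -> exists! h : khom Q Z, h ∘ p = g.

Definition is_abelian : Prop :=
  [/\ exists Z : S, is_zero_object Z,
      forall X Y : S, exists B, is_biproduct X Y B,
      forall (X Y : S) (f : khom X Y),
        (exists (K : S) (i : khom K X), is_kernel f i) /\
        (exists (Q : S) (p : khom Y Q), is_cokernel f p),
      forall (X Y : S) (f : khom X Y), is_mono f ->
        exists (Z : S) (g : khom Y Z), is_kernel g f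
    & forall (X Y : S) (f : khom X Y), is_epi f ->
        exists (Z : S) (g : khom Z X), is_cokernel g f].

(* Small sets are those living in the universe of the underlying sets of      *)
(* vector spaces, hence in that of the hom-sets of S.                         *)
Definition small := Type@{GRing.Lmodule.axioms_.u0}.

Definition is_coproduct (I : small) (X : I -> S) (C : S)
    (inj : forall i, khom (X i) C) : Prop :=
  forall Y (g : forall i, khom (X i) Y),
    exists! h : khom C Y, forall i, h ∘ inj i = g i.

Definition has_coproducts : Prop :=
  forall (I : small) (X : I -> S),
    exists (C : S) (inj : forall i, khom (X i) C), is_coproduct inj.

(* AB5 is stated with colimits over directed preorders; this is equivalent to *)
(* the exactness of all small filtered colimits.                              *)
Definition is_directed (I : small) (le : I -> I -> Prop) : Prop :=
  [/\ inhabited I, forall i, le i i,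
      forall i j l, le i j -> le j l -> le i l
    & forall i j, exists l, le i l /\ le j l].

Record direct_system (I : small) (le : I -> I -> Prop) := DirectSystem {
  dob :> I -> S;
  dmap : forall i j, le i j -> khom (dob i) (dob j);
  dmap1 : forall i (h : le i i), dmap h = kid (dob i);
  dmapM : forall i j l (h : le i j) (h' : le j l) (h'' : le i l),
    dmap h' ∘ dmap h = dmap h''
}.

Definition is_colimit I le (D : @direct_system I le) (C : S)
    (c : forall i, khom (D i) C) : Prop :=
  (forall i j (h : le i j), c j ∘ dmap D h = c i) /\
  forall Y (g : forall i, khom (D i) Y),
    (forall i j (h : le i j), g j ∘ dmap D h = g i) ->
    exists! u : khom C Y, forall i, u ∘ c i = g i.

Definition is_natural I le (D E : @direct_system I le)
    (f : forall i, khom (D i) (E i)) : Prop :=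
  forall i j (h : le i j), f j ∘ dmap D h = dmap E h ∘ f i.

Definition is_short_exact (X Y Z : S) (f : khom X Y) (g : khom Y Z) : Prop :=
  is_kernel g f /\ is_cokernel f g.

Definition directed_colimits_exact : Prop :=
  forall (I : small) (le : I -> I -> Prop), is_directed le ->
  forall (D E F : direct_system le)
    (f : forall i, khom (D i) (E i)) (g : forall i, khom (E i) (F i)),
    is_natural f -> is_natural g -> (forall i, is_short_exact (f i) (g i)) ->
  forall (C C' C'' : S) (c : forall i, khom (D i) C)
    (c' : forall i, khom (E i) C') (c'' : forall i, khom (F i) C''),
    is_colimit c -> is_colimit c' -> is_colimit c'' ->
  forall (u : khom C C') (v : khom C' C''),
    (forall i, u ∘ c i = c' i ∘ f i) -> (forall i, v ∘ c' i = c'' i ∘ g i) ->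
  is_short_exact u v.

Definition has_generator : Prop :=
  exists G : S, forall (X Y : S) (f g : khom X Y),
    (forall h : khom G X, f ∘ h = g ∘ h) -> f = g.

Definition is_grothendieck : Prop :=
  [/\ is_abelian, has_coproducts, directed_colimits_exact & has_generator].

End GrothendieckAxioms.

Record grothcat (k : fieldType) := GrothCat {
  gcat :> klincat k;
  gcatP : is_grothendieck gcat
}.

(* M ⊠ V is the object M ⊗ V of S, for M in S and V a vector space: it        *)
(* represents Y |-> {linear V -> S(M, Y)} through the universal linear map    *)
(* cin : V -> S(M, M ⊠ V), where cin v is "m |-> m ⊗ v". It exists as the     *)
(* cokernel of a map between coproducts of copies of M; copower_adjunction    *)
(* below says that M ⊠ - is left adjoint to S(M, -).                          *)
Section Copower.
Variables (k : fieldType) (S : grothcat k).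

Lemma kcompDl (X Y Z : S) a (g g' : khom Y Z) (f : khom X Y) :
  (a *: g + g') ∘ f = a *: (g ∘ f) + g' ∘ f.
Proof. exact: (kcomp_bilinear _ _ _).1. Qed.

Lemma kcompDr (X Y Z : S) a (g : khom Y Z) (f f' : khom X Y) :
  g ∘ (a *: f + f') = a *: (g ∘ f) + g ∘ f'.
Proof. exact: (kcomp_bilinear _ _ _).2. Qed.

Lemma kcomp0l (X Y Z : S) (f : khom X Y) : (0 : khom Y Z) ∘ f = 0.
Proof. exact: (bilinear0l (kcomp_bilinear X Y Z)). Qed.

Lemma kcompBr (X Y Z : S) (g : khom Y Z) (f f' : khom X Y) :
  g ∘ (f - f') = g ∘ f - g ∘ f'.
Proof. by rewrite addrC -scaleN1r kcompDr scaleN1r addrC. Qed.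

Definition precomp (X Y Z : S) (f : khom X Y) (g : khom Y Z) : khom X Z := g ∘ f.
HB.instance Definition _ X Y Z f :=
  GRing.isLinear.Build k _ _ _ (@precomp X Y Z f)
    (fun a g g' => kcompDl a g g' f).

Definition postcomp (X Y Z : S) (g : khom Y Z) (f : khom X Y) : khom X Z := g ∘ f.
HB.instance Definition _ X Y Z g :=
  GRing.isLinear.Build k _ _ _ (@postcomp X Y Z g)
    (fun a f f' => kcompDr a g f f').

Definition is_copower (M : S) (V : lmodType k) (T : S)
    (eta : {linear V -> khom M T}) : Prop :=
  forall Y (phi : {linear V -> khom M Y}),
    exists! h : khom T Y, forall v, h ∘ eta v = phi v.

Lemma copower_ex (M : S) (V : lmodType k) :
  exists T : S, exists eta : {linear V -> khom M T}, is_copower eta.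
Proof.
case: (gcatP S) => -[_ _ kers _ _] coprods _ _.
have [C [i hC]] := coprods V (fun _ => M).
have [R [j hR]] := coprods (k * V * V)%type (fun _ => M).
have [d [hd _]] := hR C (fun r => i (r.1.1 *: r.1.2 + r.2)
                                  - (r.1.1 *: i r.1.2 + i r.2)).
have [_ [T [q [qd0 hq]]]] := kers _ _ d.
have eta_lin : linear (fun v => q ∘ i v).
  move=> a v w; apply/eqP; rewrite -subr_eq0 -kcompDr -kcompBr.
  by have /= <- := hd (a, v, w); rewrite kcompA qd0 kcomp0l.
exists T, (linear_of eta_lin) => Y phi.
have [g [hg gU]] := hC Y phi.
have gd0 : g ∘ d = 0.
  have [z [_ zU]] := hR Y (fun=> 0); rewrite -(zU 0) => [|r]; last exact: kcomp0l.
  apply/esym/zU => r.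
  by rewrite -kcompA hd kcompBr kcompDr !hg linearP subrr.
have [h [hh hU]] := hq Y g gd0.
exists h; split=> [v /=|h' hh']; first by rewrite kcompA hh hg.
apply: hU; apply/esym/gU => v; rewrite -kcompA; exact: hh'.
Qed.

Definition copower (M : S) (V : lmodType k) : S := sval (cid (copower_ex M V)).
Local Notation "M ⊠ V" := (copower M V).

Definition cin (M : S) (V : lmodType k) : {linear V -> khom M (M ⊠ V)} :=
  sval (cid (svalP (cid (copower_ex M V)))).

Lemma cinP (M : S) (V : lmodType k) : is_copower (cin M V).
Proof. exact: (svalP (cid (svalP (cid (copower_ex M V))))). Qed.

Definition cdesc (M : S) (V : lmodType k) (Y : S)
    (phi : {linear V -> khom M Y}) : khom (M ⊠ V) Y := sval (cid (cinP phi)).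

Lemma cdescE (M : S) (V : lmodType k) (Y : S) (phi : {linear V -> khom M Y}) v :
  cdesc phi ∘ cin M V v = phi v.
Proof. by rewrite /cdesc; case: cid => h /= [hh _]. Qed.

Lemma copower_ext (M : S) (V : lmodType k) (Y : S) (f g : khom (M ⊠ V) Y) :
  (forall v, f ∘ cin M V v = g ∘ cin M V v) -> f = g.
Proof.
move=> fg.
have [h [_ hU]] := cinP (postcomp f \o cin M V).
by rewrite -(hU f) // -(hU g) // => v; rewrite -fg.
Qed.

Definition copower_map (M : S) (V W : lmodType k) (f : {linear V -> W}) :
  khom (M ⊠ V) (M ⊠ W) := cdesc (cin M W \o f).

Lemma copower_mapE (M : S) (V W : lmodType k) (f : {linear V -> W}) v :
  copower_map M f ∘ cin M V v = cin M W (f v).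
Proof. exact: cdescE. Qed.

Lemma copower_map_id (M : S) (V : lmodType k) :
  copower_map M (idfun : {linear V -> V}) = kid (M ⊠ V).
Proof. by apply: copower_ext => v; rewrite copower_mapE kcomp1l. Qed.

Lemma copower_map_comp (M : S) (U V W : lmodType k) (g : {linear V -> W})
    (f : {linear U -> V}) :
  copower_map M (vect_comp g f) = copower_map M g ∘ copower_map M f.
Proof.
by apply: copower_ext => v; rewrite copower_mapE -kcompA !copower_mapE.
Qed.

Definition copower_functor (M : S) : functor (vect k) (underlying_category S) :=
  @Functor (vect k) (underlying_category S) (copower M) (@copower_map M)
    (@copower_map_id M) (@copower_map_comp M).

Definition hom_functor (M : S) : functor (underlying_category S) (vect k).
Proof.
refine (@Functor (underlying_category S) (vect k) (khom M)
  (fun Y Z g => postcomp g) _ _).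
- by move=> Y; apply: linear_ext => f; apply: kcomp1l.
- by move=> X Y Z g f; apply: linear_ext => h; apply/esym/kcompA.
Defined.

Definition copower_transpose (M : S) (V : lmodType k) (Y : S)
    (h : khom (M ⊠ V) Y) : {linear V -> khom M Y} := postcomp h \o cin M V.

Definition copower_adjunction (M : S) :
  adjunction (copower_functor M) (hom_functor M).
Proof.
refine (@Adjunction _ _ (copower_functor M) (hom_functor M)
  (@copower_transpose M) _ _ _).
- move=> V Y; exists (@cdesc M V Y) => [h | phi].
    by apply: copower_ext => v; rewrite cdescE.
  by apply: linear_ext => v; apply: cdescE.
- move=> V V' Y f g; apply: linear_ext => v.
  by rewrite /= /postcomp -kcompA copower_mapE.
- move=> V Y Y' g h; apply: linear_ext => v.
  by rewrite /= /postcomp kcompA.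
Defined.

Definition copower_mapl (M M' : S) (f : khom M M') (V : lmodType k) :
  khom (M ⊠ V) (M' ⊠ V) := cdesc (precomp f \o cin M' V).

Definition copower_map2 (M M' : S) (V V' : lmodType k) (f : khom M M')
    (phi : {linear V -> V'}) : khom (M ⊠ V) (M' ⊠ V') :=
  copower_mapl f V' ∘ copower_map M phi.

Section Desc2.
Variables (M : S) (V W : lmodType k) (Y : S) (b : V -> W -> khom M Y).
Hypothesis hb : is_bilinear b.

Lemma cdesc2_linear : linear (fun w => cdesc (linear_of (hb.1 w))).
Proof.
move=> a w w'; apply: copower_ext => v.
by rewrite kcompDl !cdescE /= hb.2.
Qed.

Definition cdesc2 : khom ((M ⊠ V) ⊠ W) Y := cdesc (linear_of cdesc2_linear).

Lemma cdesc2E v w : cdesc2 ∘ cin (M ⊠ V) W w ∘ cin M V v = b v w.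
Proof. by rewrite !cdescE. Qed.

End Desc2.

Lemma cassoc_bilinear (M : S) (V W : lmodType k) :
  is_bilinear (fun v w => cin M (V ⊗ W) (v ⊙ w)).
Proof. by split=> [w a v v' | v a w w'] /=; rewrite ?tensPl ?tensPr linearP. Qed.

Definition cassoc (M : S) (V W : lmodType k) :
    khom ((M ⊠ V) ⊠ W) (M ⊠ (V ⊗ W)) :=
  cdesc2 (@cassoc_bilinear M V W).

Lemma cswap_bilinear (M : S) (V W : lmodType k) :
  is_bilinear (fun v w => cin (M ⊠ W) V v ∘ cin M W w).
Proof.
by split=> [w a v v' | v a w w'] /=; rewrite linearP ?kcompDl ?kcompDr.
Qed.

Definition cswap (M : S) (V W : lmodType k) :
    khom ((M ⊠ V) ⊠ W) ((M ⊠ W) ⊠ V) :=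
  cdesc2 (@cswap_bilinear M V W).

Lemma cunit_linear (M : S) : linear (fun a : k^o => a *: kid M).
Proof. by move=> a x y; rewrite scalerDl scalerA. Qed.

Definition cunit (M : S) : khom (M ⊠ k^o) M := cdesc (linear_of (@cunit_linear M)).

Lemma cmid_bilinear1 (M : S) (V W U : lmodType k) (v : V) :
  is_bilinear (fun w u => cin (M ⊠ W) (V ⊗ U) (v ⊙ u) ∘ cin M W w).
Proof.
split=> [u a w w' | w a u u'] /=; first by rewrite linearP kcompDr.
by rewrite tensPr linearP kcompDl.
Qed.

Lemma cmid_bilinear (M : S) (V W U : lmodType k) :
  is_bilinear (fun v => tensor_lift (fun w u =>
    cin (M ⊠ W) (V ⊗ U) (v ⊙ u) ∘ cin M W w)).
Proof.
split=> [p | v].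
  apply: (@tensor_lift_param _ _ _ _ _ (fun v w u =>
    cin (M ⊠ W) (V ⊗ U) (v ⊙ u) ∘ cin M W w)) => w u a v v'.
  by rewrite tensPl linearP kcompDl.
exact: (tensor_lift_linear (@cmid_bilinear1 M V W U v)).
Qed.

Definition cmid (M : S) (V W U : lmodType k) :
    khom ((M ⊠ V) ⊠ (W ⊗ U)) ((M ⊠ W) ⊠ (V ⊗ U)) :=
  cdesc2 (@cmid_bilinear M V W U).

Lemma cmidE (M : S) (V W U : lmodType k) (v : V) (w : W) (u : U) :
  cmid M V W U ∘ cin (M ⊠ V) (W ⊗ U) (w ⊙ u) ∘ cin M V v =
  cin (M ⊠ W) (V ⊗ U) (v ⊙ u) ∘ cin M W w.
Proof.
by rewrite cdesc2E (tensor_lift_tens _ _ (@cmid_bilinear1 M V W U v)).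
Qed.

End Copower.

Notation "M ⊠ V" := (copower M V).
Arguments cassoc {k S M V W}.
Arguments cswap {k S M V W}.
Arguments cunit {k S M}.
Arguments cmid {k S M V W U}.

(* A ⊗ M is encoded as M ⊠ A, so that a ⊗ (b ⊗ m) lives in (M ⊠ A) ⊠ A with b *)
(* in the inner factor; this is why the products of A and H are preceded by a *)
(* swap in is_left_module and in is_compatible.                               *)
Section RelativeHopfModules.
Variables (k : fieldType) (S : grothcat k) (H : hopf_algebra k).
Variable A : comodule_algebra H.

Definition is_left_module (M : S) (act : khom (M ⊠ A) M) : Prop :=
  act ∘ copower_mapl act A = act ∘ copower_map M (alg_mul A \o @tswap _ A A) ∘ cassoc
  /\ act ∘ cin M A (alg_one A) = kid M.

Definition is_right_comodule (M : S) (coact : khom M (M ⊠ H)) : Prop :=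
  cassoc ∘ copower_mapl coact H ∘ coact = copower_map M (comul H) ∘ coact
  /\ cunit ∘ copower_map M (counit H) ∘ coact = kid M.

(* coact (a m) = a_0 m_0 ⊗ a_1 m_1, where cmid yields (m_0 ⊗ a_0) ⊗ (m_1 ⊗ a_1) *)
Definition is_compatible (M : S) (act : khom (M ⊠ A) M)
    (coact : khom M (M ⊠ H)) : Prop :=
  coact ∘ act = copower_map2 act (alg_mul H \o @tswap _ H H) ∘ cmid
                ∘ copower_map2 coact (ca_coact A).

Definition is_rel_hopf_module (M : S) (act : khom (M ⊠ A) M)
    (coact : khom M (M ⊠ H)) : Prop :=
  [/\ is_left_module act, is_right_comodule coact & is_compatible act coact].

Record rel_hopf_module := RelHopfModule {
  rh_ob :> S;
  rh_act : khom (rh_ob ⊠ A) rh_ob;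
  rh_coact : khom rh_ob (rh_ob ⊠ H);
  rh_axioms : is_rel_hopf_module rh_act rh_coact
}.

Definition is_rel_hopf_morphism (M P : rel_hopf_module) (f : khom M P) : Prop :=
  f ∘ rh_act M = rh_act P ∘ copower_mapl f A /\
  rh_coact P ∘ f = copower_mapl f H ∘ rh_coact M.

Definition rel_hopf_hom (M P : rel_hopf_module) :=
  {f : khom M P | is_rel_hopf_morphism f}.

Lemma rel_hopf_hom_ext (M P : rel_hopf_module) (f g : rel_hopf_hom M P) :
  sval f = sval g -> f = g.
Proof. by case: f g => f hf [g hg] /= e; subst g; congr exist. Qed.

Lemma copower_mapl_id (M : S) V : copower_mapl (kid M) V = kid (M ⊠ V).
Proof.
by apply: copower_ext => v; rewrite cdescE kcomp1l /= /precomp kcomp1r.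
Qed.

Lemma copower_mapl_comp (M N P : S) (g : khom N P) (f : khom M N) V :
  copower_mapl (g ∘ f) V = copower_mapl g V ∘ copower_mapl f V.
Proof.
apply: copower_ext => v; rewrite cdescE -kcompA cdescE /= /precomp.
by rewrite kcompA [RHS]kcompA cdescE.
Qed.

Lemma rel_hopf_id (M : rel_hopf_module) : @is_rel_hopf_morphism M M (kid M).
Proof. by split; rewrite copower_mapl_id kcomp1l kcomp1r. Qed.

Lemma rel_hopf_comp (M N P : rel_hopf_module) (g : rel_hopf_hom N P)
    (f : rel_hopf_hom M N) : is_rel_hopf_morphism (sval g ∘ sval f).
Proof.
case: f g => f [fa fc] [g [ga gc]] /=; split; rewrite copower_mapl_comp.
  by rewrite -kcompA fa kcompA ga kcompA.
by rewrite kcompA gc -kcompA fc kcompA.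
Qed.

Definition RelHopf : category.
Proof.
refine (@Category rel_hopf_module rel_hopf_hom
  (fun M => exist _ _ (rel_hopf_id M))
  (fun M N P g f => exist _ _ (rel_hopf_comp g f)) _ _ _)
  => *; apply: rel_hopf_hom_ext; [exact: kcompA|exact: kcomp1l|exact: kcomp1r].
Defined.

Section TensorComodule.
Variable M : rel_hopf_module.

Definition tensor_act (N : comodule H) : khom ((M ⊠ N) ⊠ A) (M ⊠ N) :=
  copower_mapl (rh_act M) N ∘ cswap.

Definition tensor_coact (N : comodule H) : khom (M ⊠ N) ((M ⊠ N) ⊠ H) :=
  copower_map (M ⊠ N) (alg_mul H) ∘ cmid ∘ copower_map2 (rh_coact M) (com_coact N).

Variable objP : forall N, is_rel_hopf_module (tensor_act N) (tensor_coact N).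

Definition tensor_ob (N : comodule H) : rel_hopf_module :=
  RelHopfModule (objP N).

Variable morP : forall (N N' : comodule H) (f : comod_hom N N'),
  @is_rel_hopf_morphism (tensor_ob N) (tensor_ob N') (copower_map M (sval f)).

Definition tensor_functor : functor (Com H) RelHopf.
Proof.
refine (@Functor (Com H) RelHopf tensor_ob (fun N N' f => exist _ _ (morP f)) _ _).
- by move=> N; apply: rel_hopf_hom_ext; apply: copower_map_id.
- by move=> N N' N'' g f; apply: rel_hopf_hom_ext; apply: copower_map_comp.
Defined.

End TensorComodule.

End RelativeHopfModules.

(* Main.v *)
Require Import Defs.
From mathcomp Require Import all_boot all_algebra.
From HB Require Import structures.
From mathcomp Require Import boolp.
From mathcomp Require classical_sets.

(* A linear map phi : N -> S(M, P) corresponds to a morphism M ⊗ N -> P of      *)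
(* relative Hopf modules iff every phi(n) is A-linear and                       *)
(* coact_P ∘ phi(n) = twist (phi(n_0) ⊗ n_1), where twist (f ⊗ h) is            *)
(* m |-> f(m_0) ⊗ m_1 h. Linear maps N -> S(M, P) are the same as colinear maps *)
(* from N to the cofree comodule S(M, P) ⊗ H, and under this correspondence the *)
(* two conditions say that a fixed linear map hom_defect vanishes on the image  *)
(* of N. Hence HOM(M, P) is the largest subcomodule of S(M, P) ⊗ H on which it  *)
(* vanishes.                                                                    *)
(* The largest subcomodule of C contained in the kernel of l is the kernel of   *)
(* the colinear extension C -> X ⊗ H of l, a subcomodule because subspaces are  *)
(* direct summands.                                                             *)

Set Implicit Arguments.
Unset Strict Implicit.
Unset Printing Implicit Defensive.

Import GRing.Theory.
Local Open Scope ring_scope.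

(** Since [M ⊠ -] is left adjoint to [S(M, -)], a morphism [M ⊠ N -> P] in [S] is a linear map
    [phi : N -> S(M, P)], and [tensor_morphismP] says which [phi] are A-linear and H-colinear. No
    coaction on [S(M, P)] itself is used: [phi] is replaced by its colinear extension
    [n |-> phi(n_0) ⊗ n_1] into the cofree comodule [S(M, P) ⊗ H], where both conditions become the
    vanishing of one linear map, [hom_defect]. [largest_subcomodule] then produces the comodule
    HOM(M, P), [internal_hom_universal] shows that evaluation [M ⊠ HOM(M, P) -> P] is a universal
    arrow, and [right_adjoint_of_universal] assembles these arrows into an adjunction. That [M ⊠ N]
    is a relative Hopf module comes from [tensor_coactE], which expresses its coaction through
    [twist], together with [twist_coassoc], [twist_counit] and [twist_lact]. *)

(** * Linear algebra over a field: linear selections, pseudo-inverses, kernels *)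

Section LinearSelection.
Variables (k : fieldType) (W V : lmodType k) (R G0 : W -> V -> Prop).

Definition linear_rel (G : W -> V -> Prop) : Prop :=
  G 0 0 /\ forall a w v w' v', G w v -> G w' v' -> G (a *: w + w') (a *: v + v').

Definition partial_selection (G : W -> V -> Prop) : Prop :=
  [/\ linear_rel G, forall v, G 0 v -> v = 0,
      forall w v, G w v -> R w v & forall w v, G0 w v -> G w v].

(** Zorn's lemma on the single-valued linear relations between [G0] and [R]: a maximal one is total,
    since a vector [w0] outside its domain could be sent to any [v0] with [R w0 v0]. This replaces
    bases in infinite dimension, giving both projections and lifts. *)
Lemma linear_selection :
    linear_rel R -> (forall w, exists v, R w v) ->
    linear_rel G0 -> (forall v, G0 0 v -> v = 0) ->
    (forall w v, G0 w v -> R w v) ->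
  exists s : {linear W -> V},
    (forall w, R w (s w)) /\ (forall w v, G0 w v -> s w = v).
Proof.
move=> [R0 Rlin] Rtot G0lin G0fun G0R.
have G0P : partial_selection G0 by split.
pose T := {G | partial_selection G}.
pose le (G G' : T) := `[< forall w v, sval G w v -> sval G' w v >].
have [||||[G GP] Gmax] := @classical_sets.Zorn T le.
- by move=> G; apply/asboolP.
- by move=> G1 G2 G3 /asboolP h /asboolP h'; apply/asboolP => w v /h /h'.
- case=> G1 h1 [G2 h2] /asboolP le12 /asboolP le21; apply: eq_exist => /=.
  by apply/funext => w; apply/funext => v; apply/propext; split=> [/le12|/le21].
- move=> C Ctot.
  (* [G0] is added to the union so that the empty chain has an upper bound too. *)
  pose U w v := G0 w v \/ exists2 G, C G & sval G w v.
  have UP : partial_selection U.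
    split=> [|v [/G0fun // | [[G [_ Gf _ _]] _ /Gf //]] |
              w v [/G0R // | [[G [_ _ GR _]] _ /GR //]] | w v h]; last by left.
    split=> [|a w v w' v']; first by left; exact: G0lin.1.
    case=> [h | [G CG h]] [h' | [G' CG' h']].
    + by left; exact: G0lin.2.
    + right; exists G' => //; case: (svalP G') => Glin _ _ G0G.
      by apply: Glin.2 => //; exact: G0G.
    + right; exists G => //; case: (svalP G) => Glin _ _ G0G.
      by apply: Glin.2 => //; exact: G0G.
    + case: (Ctot _ _ CG CG') => /asboolP leG; right.
        exists G' => //; case: (svalP G') => Glin _ _ _.
        by apply: Glin.2 => //; exact: leG.
      exists G => //; case: (svalP G) => Glin _ _ _.
      by apply: Glin.2 => //; exact: leG.
  by exists (exist _ U UP) => G CG; apply/asboolP => w v h; right; exists G.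
have [[GG0 Glin] Gfun GR G0G] := GP.
have Gtot w0 : exists v, G w0 v.
  apply: contrapT => /forallNP nw0.
  have [v0 Rv0] := Rtot w0.
  pose G' w v := exists a w1 v1, [/\ G w1 v1, w = a *: w0 + w1 & v = a *: v0 + v1].
  have G'P : partial_selection G'.
    split.
    + split; first by exists 0, 0, 0; rewrite !scale0r !addr0.
      move=> a _ _ _ _ [b [w1 [v1 [h -> ->]]]] [b' [w2 [v2 [h' -> ->]]]].
      exists (a * b + b'), (a *: w1 + w2), (a *: v1 + v2); split; first exact: Glin.
        by rewrite scalerDr scalerDl scalerA addrACA.
      by rewrite scalerDr scalerDl scalerA addrACA.
    + move=> v [a [w1 [v1 [h]]]].
      have [-> | a0] := eqVneq a 0.
        by rewrite !scale0r !add0r => e ->; rewrite -e in h; exact: Gfun.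
      move=> /eqP; rewrite eq_sym addr_eq0 => /eqP e _.
      (* For [a != 0], the equation [a *: w0 + w1 = 0] would put [w0 = - a^-1 *: w1] in the domain
         of [G]. *)
      case: (nw0 (- a^-1 *: v1)).
      have -> : w0 = - a^-1 *: w1 + 0.
        by rewrite -[w0]scale1r -(mulVf a0) -scalerA e scalerN addr0 scaleNr.
      by rewrite -[X in G _ X]addr0; exact: Glin.
    + by move=> _ _ [a [w1 [v1 [/GR h -> ->]]]]; exact: Rlin.
    + by move=> w v /G0G h; exists 0, w, v; rewrite !scale0r !add0r.
  have leG : le (exist _ G GP) (exist _ G' G'P).
    by apply/asboolP => w v h; exists 0, w, v; rewrite !scale0r !add0r.
  have [e] := Gmax _ leG.
  apply: (nw0 v0); rewrite -e; exists 1, 0, 0.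
  by rewrite !scale1r !addr0.
have [s Gs] := choice Gtot.
have Gu w v : G w v -> s w = v.
  move=> h; apply/eqP; rewrite -subr_eq0; apply/eqP/Gfun.
  rewrite -(subrr w) addrC -scaleN1r [s w - v]addrC -scaleN1r.
  exact: Glin.
have slin : linear s by move=> a w w'; apply: Gu; exact: Glin.
exists (linear_of slin); split=> [w | w v /G0G /Gu //].
exact: GR.
Qed.

End LinearSelection.

Lemma linear_pseudo_inverse (k : fieldType) (V W : lmodType k) (u : {linear V -> W}) :
  exists s : {linear W -> V}, forall v, u (s (u v)) = u v.
Proof.
(* [p] is a projection of [W] onto the image of [u], and [s] a lift of [p]. *)
have [||||| p [pim pid]] := @linear_selection k W W
  (fun _ w' => exists v, w' = u v) (fun w w' => w = w' /\ exists v, w' = u v).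
- split=> [|a _ _ _ _ [v ->] [v' ->]]; first by exists 0; rewrite linear0.
  by exists (a *: v + v'); rewrite linearP.
- by move=> w; exists 0, 0; rewrite linear0.
- split=> [|a w v w' v' [-> [x ->]] [-> [x' ->]]].
    by split=> //; exists 0; rewrite linear0.
  by split=> //; exists (a *: x + x'); rewrite linearP.
- by move=> w [].
- by move=> w w' [].
have [||||| s [us _]] := @linear_selection k W V
  (fun w v => u v = p w) (fun w v => w = 0 /\ v = 0).
- by split=> [|a w v w' v' h h']; rewrite ?linear0 // !linearP h h'.
- by move=> w; have [v e] := pim w; exists v.
- by split=> // a w v w' v' [-> ->] [-> ->]; rewrite !scaler0 !addr0.
- by move=> v [].
- by move=> w v [-> ->]; rewrite !linear0.
by exists s => v; rewrite us; apply: pid; split=> //; exists v.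
Qed.

Section Kernel.
Variables (k : fieldType) (V W : lmodType k) (u : {linear V -> W}).

Record lin_ker := LinKer { lin_ker_val :> V; lin_kerP : u lin_ker_val == 0 }.
HB.instance Definition _ := [isSub for lin_ker_val].
HB.instance Definition _ := [Choice of lin_ker by <:].

Fact ker_submod : submod_closed [pred v | u v == 0].
Proof.
split=> [|a v w]; rewrite !inE ?linear0 // => /eqP h /eqP h'.
by rewrite linearP h h' scaler0 addr0.
Qed.
HB.instance Definition _ := GRing.SubChoice_isSubLmodule.Build k V
   [pred v | u v == 0] lin_ker ker_submod.

Definition ker_incl : {linear lin_ker -> V} := val.

End Kernel.

(** * Tensor products of linear maps *)

Section TensorLemmas.
Variable k : fieldType.
Implicit Types U V W X : lmodType k.

Definition tensl V W (v : V) (w : W) : V ⊗ W := v ⊙ w.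
HB.instance Definition _ V W (v : V) :=
  GRing.isLinear.Build k _ _ _ (@tensl V W v) (fun a x y => tensPr a v x y).

Definition tensr V W (w : W) (v : V) : V ⊗ W := v ⊙ w.
HB.instance Definition _ V W (w : W) :=
  GRing.isLinear.Build k _ _ _ (@tensr V W w) (fun a x y => tensPl a x y w).

Lemma tens_linear_ext V W U (f g : {linear V ⊗ W -> U}) :
  (forall v w, f (v ⊙ w) = g (v ⊙ w)) -> f =1 g.
Proof. by move=> fg; apply: tensor_ind_eq => // a x y; rewrite linearP. Qed.

Lemma tens_linear_ext3l U V W X (f g : {linear (U ⊗ V) ⊗ W -> X}) :
  (forall u v w, f ((u ⊙ v) ⊙ w) = g ((u ⊙ v) ⊙ w)) -> f =1 g.
Proof.
move=> fg; apply: tens_linear_ext => p w; move: p.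
apply: (tens_linear_ext (f := f \o tensr w) (g := g \o tensr w)) => u v.
exact: fg.
Qed.

(** The inverse associator is composed from [tassoc] and swaps, so that its linearity is
    inherited. *)
Definition tassocV U V W : U ⊗ (V ⊗ W) -> (U ⊗ V) ⊗ W :=
  tmap (@tswap _ V U) idfun \o @tswap _ W (V ⊗ U) \o @tassoc _ W V U
  \o tmap (@tswap _ V W) idfun \o @tswap _ U (V ⊗ W).
HB.instance Definition _ U V W := GRing.Linear.on (@tassocV U V W).

Lemma tassocVE U V W (u : U) (v : V) (w : W) :
  tassocV (u ⊙ (v ⊙ w)) = (u ⊙ v) ⊙ w.
Proof.
by rewrite /tassocV /= tswapE tmapE /= tswapE tassocE tswapE tmapE /= tswapE.
Qed.

Lemma tmap_tmap V V' V'' W W' W'' (f : {linear V -> V'}) (f' : {linear V' -> V''})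
    (g : {linear W -> W'}) (g' : {linear W' -> W''}) t :
  tmap f' g' (tmap f g t) = tmap (f' \o f) (g' \o g) t.
Proof. by apply: esym; exact: tmap_comp. Qed.

Lemma eq_tmap V V' W W' (f f' : {linear V -> V'}) (g g' : {linear W -> W'}) :
  f =1 f' -> g =1 g' -> tmap f g =1 tmap f' g'.
Proof. by move=> /linear_ext -> /linear_ext ->. Qed.

Lemma tunitr_tmap V V' (f : {linear V -> V'}) t :
  tunitr (tmap f idfun t) = f (tunitr t).
Proof.
apply: (tens_linear_ext (f := @tunitr _ V' \o tmap f idfun) (g := f \o @tunitr _ V)) t => v a.
by rewrite /= tmapE !tunitrE linearZ.
Qed.

Lemma tassoc_tmap U V W U' V' W' (f : {linear U -> U'}) (g : {linear V -> V'})
    (h : {linear W -> W'}) t :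
  tassoc (tmap (tmap f g) h t) = tmap f (tmap g h) (tassoc t).
Proof.
apply: (tens_linear_ext3l (f := @tassoc _ _ _ _ \o tmap (tmap f g) h)
  (g := tmap f (tmap g h) \o @tassoc _ _ _ _)) t => u v w.
by rewrite /= tassocE !tmapE /= !tmapE tassocE.
Qed.

Lemma tassoc_tmapl U V W U' (f : {linear U -> U'}) t :
  tassoc (tmap (tmap f idfun) idfun t) = tmap f idfun (@tassoc _ U V W t).
Proof. by rewrite tassoc_tmap; apply: eq_tmap => // s; exact: tmap_idfun. Qed.

Lemma tmap0l V V' W W' (g : {linear W -> W'}) (t : V ⊗ W) :
  tmap (\0 : {linear V -> V'}) g t = 0.
Proof.
apply: (tens_linear_ext (f := tmap \0 g) (g := \0)) => v w.
by rewrite /= tmapE [LHS](linear0 (tensr (g w))).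
Qed.

(** For a pseudo-inverse [s] of [u], the map [p = id - s u] retracts [V] onto the kernel. Tensoring
    [id = i p + s u] with [X], where [i] is the inclusion, shows that the kernel of [u ⊗ X] lies in
    [ker u ⊗ X]. *)
Lemma ker_split V W (u : {linear V -> W}) :
  exists p : {linear V -> lin_ker u},
    cancel (ker_incl u) p /\
    forall X (t : V ⊗ X), tmap u idfun t = 0 -> tmap (ker_incl u \o p) idfun t = t.
Proof.
have [s us] := linear_pseudo_inverse u.
have pP v : u (v - s (u v)) == 0 by rewrite linearB /= us subrr.
pose p v := LinKer (pP v).
have plin : linear p.
  move=> a v w; apply: val_inj => /=.
  by rewrite 2!linearP /= scalerBr opprD addrACA.
exists (linear_of plin); split=> [x | X t ut].
  by apply: val_inj => /=; rewrite (eqP (lin_kerP x)) linear0 subr0.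
suff e : tmap (ker_incl u \o linear_of plin) idfun t + tmap s idfun (tmap u idfun t) = t.
  by rewrite -[RHS]e ut linear0 addr0.
apply: (tens_linear_ext (f := (tmap (ker_incl u \o linear_of plin) idfun
   \+ (tmap s idfun \o tmap u idfun))) (g := idfun)) => v x.
by rewrite /= !tmapE /= -[LHS](linearD (tensr x)) subrK.
Qed.

End TensorLemmas.

(** * Cofree comodules and largest subcomodules *)

Section Comodules.
Variables (k : fieldType) (H : hopf_algebra k).

Section Cofree.
Variable V : lmodType k.

Definition cofree_coact : V ⊗ H -> (V ⊗ H) ⊗ H :=
  @tassocV _ V H H \o tmap idfun (comul H).
HB.instance Definition _ := GRing.Linear.on cofree_coact.

Lemma cofree_coactE v h : cofree_coact (v ⊙ h) = tassocV (v ⊙ comul H h).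
Proof. by rewrite /cofree_coact /= tmapE. Qed.

Lemma cofree_coactP : is_coaction cofree_coact.
Proof.
split.
  apply: (tens_linear_ext
    (f := @tassoc _ _ _ _ \o tmap cofree_coact idfun \o cofree_coact)
    (g := tmap idfun (comul H) \o cofree_coact)) => v h.
  (* The factor [v] is carried along by [tensl v], so that [natl] and [natr] reduce the claim to
     coassociativity of [H]. *)
  have natl q : tassoc (tmap cofree_coact idfun (tassocV (v ⊙ q))) =
      tassoc (tmap (@tassocV _ V H H \o tensl v) idfun (tmap (comul H) idfun q)).
    apply: (tens_linear_ext
      (f := @tassoc _ _ _ _ \o tmap cofree_coact idfun \o @tassocV _ _ _ _ \o tensl v)
      (g := @tassoc _ _ _ _ \o tmap (@tassocV _ V H H \o tensl v) idfun
            \o tmap (comul H) idfun)) q => a b.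
    by rewrite /= /tensl tassocVE !tmapE /= cofree_coactE.
  have natr q : tmap idfun (comul H) (tassocV (v ⊙ q)) =
      tmap (tensl v) idfun (tmap idfun (comul H) q).
    apply: (tens_linear_ext
      (f := tmap idfun (comul H) \o @tassocV _ _ _ _ \o tensl v)
      (g := tmap (tensl v) idfun \o tmap idfun (comul H))) q => a b.
    by rewrite /= /tensl tassocVE !tmapE.
  rewrite /= cofree_coactE natl natr -comulA.
  move: (tmap _ _ (comul H h)); apply: (tens_linear_ext3l
      (f := @tassoc _ _ _ _ \o tmap (@tassocV _ V H H \o tensl v) idfun)
      (g := tmap (tensl v) idfun \o @tassoc _ _ _ _)) => a b c.
  by rewrite /= tmapE /= /tensl tassocVE !tassocE tmapE.
apply: (tens_linear_ext (f := @tunitr _ _ \o tmap idfun (counit H) \o cofree_coact)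
  (g := idfun)) => v h.
rewrite /= cofree_coactE -[in RHS](counitr h).
apply: (tens_linear_ext (f := @tunitr _ _ \o tmap idfun (counit H) \o @tassocV _ _ _ _ \o tensl v)
  (g := tensl v \o @tunitr _ _ \o tmap idfun (counit H))) => a b.
by rewrite /= /tensl tassocVE !tmapE !tunitrE -[RHS]/(tensl _ _) linearZ.
Qed.

Definition cofree : comodule H := Comodule cofree_coactP.

Definition cofree_eval : cofree -> V := @tunitr _ V \o tmap idfun (counit H).
HB.instance Definition _ := GRing.Linear.on cofree_eval.

Lemma cofree_evalE v h : cofree_eval (v ⊙ h) = counit H h *: v.
Proof. by rewrite /cofree_eval /= tmapE tunitrE. Qed.

Lemma cofree_coactK (t : cofree) : tmap cofree_eval idfun (com_coact cofree t) = t.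
Proof.
apply: (tens_linear_ext (f := tmap cofree_eval idfun \o cofree_coact) (g := idfun)) t => v h.
rewrite /= cofree_coactE -[in RHS](counitl h).
apply: (tens_linear_ext (f := tmap cofree_eval idfun \o @tassocV _ _ _ _ \o tensl v)
  (g := tensl v \o @tunitr _ _ \o @tswap _ _ _ \o tmap (counit H) idfun)) => a b.
rewrite /= /tensl tassocVE !tmapE /= tswapE tunitrE cofree_evalE.
by rewrite [LHS](linearZ_LR (tensr b)) [RHS](linearZ_LR (tensl v)).
Qed.

End Cofree.

Section Coextension.
Variables (N : comodule H) (V : lmodType k).

(** The map [n |-> f(n_0) ⊗ n_1], transpose of [f] under the adjunction between forgetting the
    coaction and [cofree]. The lemmas [cofree_eval_coextend] and [coextend_eval] are the two halves
    of the bijection. *)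
Definition coextend (f : {linear N -> V}) : {linear N -> cofree V} :=
  tmap f idfun \o com_coact N.

Lemma coextend_colinear f : is_colinear (coextend f).
Proof.
move=> n; set r := com_coact N n.
have nat q : tassocV (tmap idfun (comul H) (tmap f idfun q)) =
    tassocV (tmap f idfun (tmap idfun (comul H) q)).
  by rewrite !tmap_tmap; congr tassocV; apply: eq_tmap.
transitivity (tassocV (tmap idfun (comul H) (tmap f idfun r))); first by [].
rewrite nat -(com_coactP N).1 -/r.
have -> : tmap (coextend f) idfun r = tmap (tmap f idfun) idfun (tmap (com_coact N) idfun r).
  by rewrite tmap_tmap; apply: eq_tmap.
move: (tmap (com_coact N) idfun r); apply: (tens_linear_ext3l
  (f := @tassocV _ _ _ _ \o tmap f idfun \o @tassoc _ _ _ _)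
  (g := tmap (tmap f idfun) idfun)) => a b c.
by rewrite /= tassocE !tmapE tassocVE /= tmapE.
Qed.

Lemma cofree_eval_coextend f : @cofree_eval V \o coextend f =1 f.
Proof.
move=> n; rewrite /= /cofree_eval /= tmap_tmap.
rewrite -[in RHS]((com_coactP N).2 n) -tunitr_tmap tmap_tmap.
by congr tunitr; apply: eq_tmap.
Qed.

Lemma coextend_eval (g : {linear N -> cofree V}) :
  is_colinear g -> coextend (@cofree_eval V \o g) =1 g.
Proof.
move=> gcol n; rewrite -[RHS]cofree_coactK gcol tmap_tmap.
by apply: eq_tmap.
Qed.

Lemma coextend_comp (N' : comodule H) (h : {linear N' -> N}) (f : {linear N -> V}) n :
  is_colinear h -> coextend f (h n) = tmap (f \o h) idfun (com_coact N' n).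
Proof. by move=> hcol; rewrite /= hcol tmap_tmap; apply: eq_tmap. Qed.

End Coextension.

(** Let [K] be the kernel of [u = coextend l]. As [u] is colinear, [u ⊗ H] kills the coaction of an
    element of [K], so by [ker_split] this coaction lies in [K ⊗ H]. The map [l] vanishes on [K]
    because it is [u] followed by [cofree_eval]. Any colinear [g] with [l g = 0] lands in [K]
    because [u g] is the coextension of [l g]. *)
Lemma largest_subcomodule (C : comodule H) (X : lmodType k) (l : {linear C -> X}) :
  exists (K : comodule H) (i : comod_hom K C),
    [/\ injective (sval i), forall x, l (sval i x) = 0
      & forall (N : comodule H) (g : comod_hom N C), (forall n, l (sval g n) = 0) ->
        exists h : comod_hom N K, forall n, sval i (sval h n) = sval g n].
Proof.
pose u := coextend l.
have [p [iK kerP]] := ker_split u.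
pose i := ker_incl u.
pose r : {linear lin_ker u -> lin_ker u ⊗ H} := tmap p idfun \o com_coact C \o i.
have ker0 x : tmap u idfun (com_coact C (i x)) = 0.
  by rewrite -coextend_colinear (eqP (lin_kerP x)) linear0.
have ir x : tmap i idfun (r x) = com_coact C (i x).
  by rewrite -[RHS]kerP // [LHS]tmap_tmap; apply: eq_tmap.
(* [i ⊗ Z] is split by [p ⊗ Z]; the coaction axioms of [K] can thus be checked inside [C]. *)
have inj (Z : lmodType k) : injective (tmap i (idfun : {linear Z -> Z})).
  apply: (can_inj (g := tmap p idfun)) => t; rewrite tmap_tmap -[RHS]tmap_idfun.
  by apply: eq_tmap => // x; exact: iK.
have rP : is_coaction r.
  split=> x.
    apply: inj; rewrite -tassoc_tmapl tmap_tmap.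
    rewrite (eq_tmap (f' := com_coact C \o i) (g' := idfun \o idfun)) // -tmap_tmap.
    rewrite ir (com_coactP C).1 -ir !tmap_tmap; exact: eq_tmap.
  apply: (can_inj iK); rewrite -tunitr_tmap -[RHS](com_coactP C).2.
  rewrite tmap_tmap -ir tmap_tmap; congr tunitr; exact: eq_tmap.
pose K := Comodule rP.
have icol : @is_colinear _ _ K C i by move=> x; rewrite /= ir.
exists K, (exist _ i icol); split=> [|x|N g g0].
- exact: can_inj iK.
- transitivity (cofree_eval (u (i x))); first exact/esym/(cofree_eval_coextend l).
  by rewrite (eqP (lin_kerP x)) linear0.
have ug n : u (sval g n) == 0.
  rewrite /u coextend_comp; last exact: svalP.
  by rewrite (eq_tmap (f' := \0) (g' := idfun)) // tmap0l.
pose h n := LinKer (ug n).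
have hlin : linear h by move=> a v w; apply: val_inj; rewrite /= linearP.
have hcol : @is_colinear _ _ N K (linear_of hlin).
  move=> n; apply: inj; rewrite [RHS]tmap_tmap.
  transitivity (com_coact C (sval g n)); first exact: (esym (icol (h n))).
  by rewrite (svalP g); exact: eq_tmap.
by exists (exist _ _ hcol).
Qed.

End Comodules.

(** * Right adjoints from universal arrows *)

(** On a morphism [h], the right adjoint is the factorization of [h e_Y] through the universal arrow
    of the target; functoriality and naturality both follow from uniqueness of factorizations
    ([adjU]). *)
Lemma right_adjoint_of_universal (C D : category) (F : functor C D) :
    (forall Y : D, exists (G : C) (e : Defs.hom (F G) Y), forall X (g : Defs.hom (F X) Y),
      exists! h : Defs.hom X G, ccomp e (fmap F h) = g) ->
  exists G : functor D C, inhabited (adjunction F G).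
Proof.
move=> univ.
have [G0 univ1] := choice univ.
pose e Y := sval (cid (univ1 Y)).
have eP Y X (g : Defs.hom (F X) Y) : exists! h, ccomp (e Y) (fmap F h) = g.
  exact: svalP (cid (univ1 Y)) X g.
pose adj0 X Y (g : Defs.hom (F X) Y) : Defs.hom X (G0 Y) := sval (cid (eP _ _ g)).
have adjE X Y g : ccomp (e Y) (fmap F (@adj0 X Y g)) = g.
  by rewrite /adj0; case: cid => h [].
have adjU X Y g h : ccomp (e Y) (fmap F h) = g -> @adj0 X Y g = h.
  by move=> hg; rewrite /adj0; case: cid => h' /= [_]; apply.
pose map Y Y' (h : Defs.hom Y Y') := adj0 _ _ (ccomp h (e Y)).
have map1 Y : map Y Y (idm Y) = idm (G0 Y).
  by apply: adjU; rewrite fmap1 comp1l comp1r.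
have mapM X Y Z (g : Defs.hom Y Z) (f : Defs.hom X Y) :
    map _ _ (ccomp g f) = ccomp (map _ _ g) (map _ _ f).
  by apply: adjU; rewrite fmapM Defs.compA adjE -Defs.compA adjE Defs.compA.
exists (Functor map1 mapM); split; exists adj0.
- move=> X Y; exists (fun h => ccomp (e Y) (fmap F h)) => [g | h]; first exact: adjE.
  exact: adjU.
- by move=> X X' Y f g; apply: adjU; rewrite fmapM Defs.compA adjE.
- by move=> X Y Y' g h; apply: adjU; rewrite fmapM Defs.compA adjE -Defs.compA adjE.
Qed.

(** * Calculus of copowers on generalized elements [cin] *)

Section Copowers.
Variables (k : fieldType) (S : grothcat k).
Implicit Types (M X Y Z : S) (U V W : lmodType k).

Lemma kcompZl X Y Z a (g : khom Y Z) (f : khom X Y) : (a *: g) ∘ f = a *: (g ∘ f).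
Proof. exact: (linearZ_LR (precomp f)). Qed.

Lemma kcompZr X Y Z a (g : khom Y Z) (f : khom X Y) : g ∘ (a *: f) = a *: (g ∘ f).
Proof. exact: (linearZ_LR (postcomp g)). Qed.

Lemma copower_maplE M M' (f : khom M M') V v :
  copower_mapl f V ∘ cin M V v = cin M' V v ∘ f.
Proof. exact: cdescE. Qed.

(* [copower_map2] unfolds to a composite, which makes rewriting with [kcompA]
   see through it; this version does not. *)
Definition bimap M M' V W (f : khom M M') (phi : {linear V -> W}) :
  khom (M ⊠ V) (M' ⊠ W) := cdesc (precomp f \o cin M' W \o phi).

Lemma bimapE M M' V W (f : khom M M') (phi : {linear V -> W}) v :
  bimap f phi ∘ cin M V v = cin M' W (phi v) ∘ f.
Proof. exact: cdescE. Qed.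

Lemma copower_map2_bimap M M' V W (f : khom M M') (phi : {linear V -> W}) :
  copower_map2 f phi = bimap f phi.
Proof.
by apply: copower_ext => v; rewrite bimapE -kcompA copower_mapE copower_maplE.
Qed.

Lemma cassocE M V W v w : cassoc ∘ cin (M ⊠ V) W w ∘ cin M V v = cin M (V ⊗ W) (v ⊙ w).
Proof. exact: (cdesc2E (@cassoc_bilinear k S M V W)). Qed.

Lemma cswapE M V W v w :
  cswap ∘ cin (M ⊠ V) W w ∘ cin M V v = cin (M ⊠ W) V v ∘ cin M W w.
Proof. exact: (cdesc2E (@cswap_bilinear k S M V W)). Qed.

Lemma cunitE M a : cunit ∘ cin M k^o a = a *: kid M.
Proof. exact: cdescE. Qed.

Lemma copower_ext2 M V W Y (f g : khom ((M ⊠ V) ⊠ W) Y) :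
  (forall v w, f ∘ cin (M ⊠ V) W w ∘ cin M V v = g ∘ cin (M ⊠ V) W w ∘ cin M V v) -> f = g.
Proof. by move=> fg; apply: copower_ext => w; apply: copower_ext => v. Qed.

(** Here and in [bimap_linear] and [diag_act_linear], a morphism with a vector parameter is
    presented as a linear map of that parameter; when the parameter is a tensor, [tens_linear_ext]
    then reduces identities to pure tensors. *)
Lemma kcomp_copower_linear M V X Y (g : khom (M ⊠ V) Y) (f : khom X M) :
  linear (fun v => g ∘ cin M V v ∘ f).
Proof. by move=> a v w; rewrite linearP kcompDr kcompDl. Qed.

Lemma bimap_linear M M' X V W (U : lmodType k) (f : khom M M')
    (phi : U -> {linear V -> W}) (z : khom X (M ⊠ V)) :
  (forall v, linear (phi^~ v)) -> linear (fun u => bimap f (phi u) ∘ z).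
Proof.
move=> philin a u u'; rewrite -kcompDl; congr (_ ∘ _).
apply: copower_ext => v; rewrite kcompDl !bimapE.
by rewrite philin linearP kcompDl.
Qed.

End Copowers.

(** * The map [twist : S(M, X) ⊗ H -> S(M, X ⊠ H)] *)

Section Twist.
Variables (k : fieldType) (S : grothcat k) (H : hopf_algebra k).
Implicit Types (M X Y : S).

Definition rmul (h : H) : {linear H -> H} := alg_mul H \o tensr h.

Lemma rmulE g h : rmul h g = alg_mul H (g ⊙ h).
Proof. by []. Qed.

Section Def.
Variables (M : S) (coact : khom M (M ⊠ H)) (X : S).

Lemma twist_bilinear :
  is_bilinear (fun (f : khom M X) (h : H) => bimap f (rmul h) ∘ coact).
Proof.
split=> [h a f f' | f a h h'] /=.
  rewrite -kcompDl; congr (_ ∘ _); apply: copower_ext => v.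
  by rewrite kcompDl !bimapE kcompDr.
apply: bimap_linear => g b h1 h2.
by rewrite !rmulE tensPr linearP.
Qed.

Definition twist : khom M X ⊗ H -> khom M (X ⊠ H) :=
  tensor_lift (fun f h => bimap f (rmul h) ∘ coact).
HB.instance Definition _ :=
  GRing.isLinear.Build k _ _ _ twist (tensor_lift_linear twist_bilinear).

Lemma twistE f h : twist (f ⊙ h) = bimap f (rmul h) ∘ coact.
Proof. exact: tensor_lift_tens twist_bilinear. Qed.

End Def.
Arguments twist {M} coact X t.

Section Coaction.
Variables (M : S) (coact : khom M (M ⊠ H)).

Lemma twist_nat X Y (g : khom X Y) t :
  copower_mapl g H ∘ twist coact X t = twist coact Y (tmap (postcomp g) idfun t).
Proof.
apply: (tens_linear_ext (f := postcomp (copower_mapl g H) \o twist coact X)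
  (g := twist coact Y \o tmap (postcomp g) idfun)) => f h.
rewrite /= tmapE !twistE /postcomp kcompA; congr (_ ∘ _).
apply: copower_ext => v.
by rewrite bimapE -kcompA bimapE kcompA copower_maplE kcompA.
Qed.

Hypothesis coactP : is_right_comodule coact.

(** At [f ⊗ h] both sides are [m |-> f(m_0) ⊗ m_1 h_1 ⊗ m_2 h_2], by coassociativity of [coact] and
    multiplicativity of the comultiplication of [H]. *)
Lemma twist_coassoc X t :
  cassoc ∘ twist coact (X ⊠ H) (tmap (twist coact X) idfun (cofree_coact t)) =
  copower_map X (comul H) ∘ twist coact X t.
Proof.
pose mul2 := tmap (alg_mul H) (alg_mul H) \o @tmid _ H H H H.
apply: (tens_linear_ext
  (f := postcomp cassoc \o twist coact (X ⊠ H) \o tmap (twist coact X) idfun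
        \o @cofree_coact k H _)
  (g := postcomp (copower_map X (comul H)) \o twist coact X)) => f h.
rewrite /= cofree_coactE twistE /postcomp.
(* [phi q] is [g |-> comul(g) q], a product in [H ⊗ H]. Replacing [comul H h] by an arbitrary [q]
   makes the left side linear in [q], so that pure tensors suffice. *)
pose phi q : {linear H -> H ⊗ H} := mul2 \o tensr q \o comul H.
have philin v : linear (phi^~ v).
  by move=> a q q'; rewrite /phi /= /tensr tensPr linearP linearP.
have -> q : cassoc ∘ twist coact (X ⊠ H) (tmap (twist coact X) idfun (tassocV (f ⊙ q))) =
    bimap f (phi q) ∘ coact.
  apply: (tens_linear_ext
    (f := postcomp cassoc \o twist coact (X ⊠ H) \o tmap (twist coact X) idfun
          \o @tassocV _ _ _ _ \o tensl f)
    (g := linear_of (bimap_linear f coact philin))) => a b.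
  rewrite /= /tensl tassocVE tmapE twistE /= twistE /postcomp.
  have e : cassoc ∘ bimap (bimap f (rmul a)) (rmul b) =
      bimap f (mul2 \o tensr (a ⊙ b)) ∘ cassoc.
    apply: copower_ext2 => v w.
    transitivity (cin X _ (rmul a v ⊙ rmul b w) ∘ f).
      rewrite -[cassoc ∘ _ ∘ cin _ _ w]kcompA bimapE -!kcompA bimapE.
      by rewrite !kcompA cassocE.
    rewrite -!kcompA [cassoc ∘ (_ ∘ _)]kcompA cassocE bimapE.
    by rewrite /mul2 /= /tensr tmidE tmapE.
  have {}e : cassoc ∘ bimap (bimap f (rmul a) ∘ coact) (rmul b) =
      bimap f (mul2 \o tensr (a ⊙ b)) ∘ cassoc ∘ copower_mapl coact H.
    rewrite -e -!kcompA; congr (_ ∘ _); apply: copower_ext => v.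
    by rewrite -kcompA copower_maplE kcompA !bimapE kcompA.
  (* Coassociativity of [coact] enters here. *)
  rewrite [LHS]kcompA e -!kcompA [cassoc ∘ (_ ∘ _)]kcompA coactP.1 kcompA; congr (_ ∘ _).
  by apply: copower_ext => v; rewrite -kcompA copower_mapE !bimapE.
rewrite kcompA; congr (_ ∘ _); apply: copower_ext => v.
rewrite bimapE -kcompA bimapE kcompA copower_mapE; congr (cin _ _ _ ∘ _).
by rewrite /= comulM tmapE.
Qed.

(** At [f ⊗ h] this says that [f(m_0)] scaled by [counit(m_1 h)] is [f(m)] scaled by [counit(h)], as
    the counit is multiplicative. *)
Lemma twist_counit X t :
  cunit ∘ copower_map X (counit H) ∘ twist coact X t = tunitr (tmap idfun (counit H) t).
Proof.
apply: (tens_linear_ext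
  (f := postcomp (cunit ∘ copower_map X (counit H)) \o twist coact X)
  (g := @tunitr _ _ \o tmap idfun (counit H))) => f h.
rewrite /= tmapE tunitrE twistE /postcomp.
transitivity (counit H h *: f ∘ (cunit ∘ copower_map M (counit H) ∘ coact)); last first.
  by rewrite coactP.2 kcomp1r.
rewrite !kcompA; congr (_ ∘ _); apply: copower_ext => v.
rewrite -!kcompA bimapE copower_mapE cunitE [copower_map _ _ ∘ (_ ∘ f)]kcompA.
rewrite copower_mapE kcompA cunitE /= counitM.
by rewrite kcompZl kcomp1l kcompZl kcompZr kcomp1r scalerA mulrC.
Qed.

End Coaction.
End Twist.
Arguments twist {k S H M} coact X t.

(** * Relative Hopf modules element by element, and the object [M ⊠ N] *)

Section RelHopf.
Variables (k : fieldType) (S : grothcat k) (H : hopf_algebra k) (A : comodule_algebra H).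
Implicit Types X Y Z : S.

Section Action.
Variables (X : S) (act : khom (X ⊠ A) X).

Definition lact (a : A) : khom X X := act ∘ cin X A a.

Lemma left_moduleP :
  is_left_module act <->
  (forall a b, lact a ∘ lact b = lact (alg_mul A (a ⊙ b))) /\ lact (alg_one A) = kid X.
Proof.
have e a b : act ∘ copower_mapl act A ∘ cin (X ⊠ A) A a ∘ cin X A b = lact a ∘ lact b.
  by rewrite -[act ∘ _ ∘ _]kcompA copower_maplE /lact !kcompA.
have e' a b : act ∘ copower_map X (alg_mul A \o @tswap _ A A) ∘ cassoc
      ∘ cin (X ⊠ A) A a ∘ cin X A b = lact (alg_mul A (a ⊙ b)).
  by rewrite -!kcompA [cassoc ∘ (_ ∘ _)]kcompA cassocE copower_mapE /= tswapE.
split=> -[assoc one]; split=> //.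
  by move=> a b; rewrite -e assoc e'.
by apply: copower_ext2 => b a; rewrite e e'.
Qed.

Definition lmul (h : H) : {linear H -> H} := alg_mul H \o tensl h.

(** The diagonal action of [A ⊗ H] on [X ⊠ H]: [a ⊗ h] sends [x ⊗ g] to [a x ⊗ h g]. Compatibility
    then says that [coact] carries the action of [a] to that of [ca_coact A a]. *)
Definition diag_act (q : A ⊗ H) : khom (X ⊠ H) (X ⊠ H) :=
  bimap act (alg_mul H \o @tswap _ H H) ∘ cmid ∘ cin (X ⊠ H) (A ⊗ H) q.

Lemma diag_act_linear Y Z (f : khom Y (X ⊠ H)) (g : khom (X ⊠ H) Z) :
  linear (fun q => g ∘ diag_act q ∘ f).
Proof. by move=> a q q'; rewrite /diag_act linearP kcompDr kcompDr kcompDl. Qed.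

Lemma diag_actE a h : diag_act (a ⊙ h) = bimap (lact a) (lmul h).
Proof.
apply: copower_ext => g; rewrite -!kcompA [cmid ∘ _]kcompA cmidE kcompA bimapE -kcompA.
by rewrite [RHS]bimapE /= tswapE.
Qed.

Lemma is_compatibleP (coact : khom X (X ⊠ H)) :
  is_compatible act coact <->
  forall a, coact ∘ lact a = diag_act (ca_coact A a) ∘ coact.
Proof.
rewrite /is_compatible !copower_map2_bimap.
have e a : bimap act (alg_mul H \o @tswap _ H H) ∘ cmid ∘ bimap coact (ca_coact A)
    ∘ cin X A a = diag_act (ca_coact A a) ∘ coact.
  by rewrite -[LHS]kcompA bimapE kcompA.
split=> [comp a | comp]; first by rewrite -e -comp kcompA.
by apply: copower_ext => a; rewrite e -comp kcompA.
Qed.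

End Action.

Definition act_linear (X Y : S) (actX : khom (X ⊠ A) X) (actY : khom (Y ⊠ A) Y)
    (f : khom X Y) :=
  f ∘ actX = actY ∘ copower_mapl f A.

Lemma act_linearP X Y (actX : khom (X ⊠ A) X) (actY : khom (Y ⊠ A) Y) (f : khom X Y) :
  act_linear actX actY f <-> forall a, f ∘ lact actX a = lact actY a ∘ f.
Proof.
split=> [lin a | lin]; first by rewrite /lact kcompA lin -!kcompA copower_maplE.
by apply: copower_ext => a; rewrite -!kcompA copower_maplE [RHS]kcompA -lin.
Qed.

(** Left and right multiplications in [H] commute. This is what makes [twist] respect the diagonal
    action in [twist_lact]. *)
Lemma diag_act_bimap X Y (actX : khom (X ⊠ A) X) (actY : khom (Y ⊠ A) Y) f h q :
  act_linear actX actY f ->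
  bimap f (rmul h) ∘ diag_act actX q = diag_act actY q ∘ bimap f (rmul h).
Proof.
move=> /act_linearP lin.
(* Identities are inserted to give both sides the shape of [diag_act_linear]. *)
rewrite -[LHS]kcomp1r -[RHS]kcomp1l [RHS]kcompA; apply: (tens_linear_ext
  (f := linear_of (diag_act_linear actX (kid _) (bimap f (rmul h))))
  (g := linear_of (diag_act_linear actY (bimap f (rmul h)) (kid _)))) => a g /=.
rewrite kcomp1r kcomp1l !diag_actE; apply: copower_ext => v.
rewrite -[LHS]kcompA -[RHS]kcompA !bimapE [LHS]kcompA [RHS]kcompA !bimapE.
rewrite -[LHS]kcompA -[RHS]kcompA lin; congr (cin _ _ _ ∘ _).
by rewrite /= /tensr /tensl alg_mulA.
Qed.

Section TensorObject.
Variables (M : rel_hopf_module S A).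

Let coactP : is_right_comodule (rh_coact M). Proof. by case: (rh_axioms M). Qed.

Lemma twist_lact X (act : khom (X ⊠ A) X) f h a :
  act_linear (rh_act M) act f ->
  twist (rh_coact M) X (f ⊙ h) ∘ lact (rh_act M) a =
  diag_act act (ca_coact A a) ∘ twist (rh_coact M) X (f ⊙ h).
Proof.
move=> lin; rewrite twistE -kcompA.
have [_ _ /is_compatibleP ->] := rh_axioms M.
by rewrite [LHS]kcompA [RHS]kcompA (diag_act_bimap _ _ lin).
Qed.

Variable N : comodule H.

Lemma tensor_actE a : lact (tensor_act M N) a = copower_mapl (lact (rh_act M) a) N.
Proof.
apply: copower_ext => n; rewrite copower_maplE.
by rewrite -!kcompA [cswap ∘ _]kcompA cswapE kcompA copower_maplE -kcompA.
Qed.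

Lemma cin_act_linear n : act_linear (rh_act M) (tensor_act M N) (cin M N n).
Proof. by apply/act_linearP => a; rewrite tensor_actE copower_maplE. Qed.

(** The coaction [m ⊗ n |-> m_0 ⊗ n_0 ⊗ m_1 n_1] is read as [twist] applied to the coextension of
    [cin M N], which transfers the properties of [twist] to [M ⊠ N]. *)
Lemma tensor_coactE n :
  tensor_coact M N ∘ cin M N n =
  twist (rh_coact M) (M ⊠ N) (tmap (cin M N) idfun (com_coact N n)).
Proof.
rewrite /tensor_coact copower_map2_bimap -[LHS]kcompA bimapE.
move: (com_coact N n) => t; rewrite kcompA; apply: (tens_linear_ext
  (f := linear_of (kcomp_copower_linear
      (copower_map (M ⊠ N) (alg_mul H) ∘ cmid) (rh_coact M)))
  (g := twist (rh_coact M) (M ⊠ N) \o tmap (cin M N) idfun)) t => {}n h.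
rewrite /= tmapE twistE; congr (_ ∘ _); apply: copower_ext => g.
by rewrite bimapE -!kcompA [cmid ∘ _]kcompA cmidE kcompA copower_mapE.
Qed.

Lemma tensor_module : is_left_module (tensor_act M N).
Proof.
have [/left_moduleP [assoc one] _ _] := rh_axioms M.
apply/left_moduleP; split=> [a b|]; rewrite !tensor_actE.
  by rewrite -copower_mapl_comp assoc.
by rewrite one copower_mapl_id.
Qed.

Lemma tensor_comodule : is_right_comodule (tensor_coact M N).
Proof.
pose phi := coextend (cin M N).
have e n : tensor_coact M N ∘ cin M N n = twist (rh_coact M) (M ⊠ N) (phi n).
  exact: tensor_coactE.
split; apply: copower_ext => n; rewrite -[LHS]kcompA e.
  rewrite -[RHS]kcompA e -twist_coassoc // -[LHS]kcompA twist_nat; congr (cassoc ∘ _).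
  rewrite -[cofree_coact _]/(com_coact (cofree H _) _) coextend_colinear !tmap_tmap.
  by congr (twist _ _ _); apply: eq_tmap => {}n //; exact: e.
rewrite twist_counit // -[LHS]/(cofree_eval (phi n)).
by rewrite [LHS](cofree_eval_coextend (cin M N)) kcomp1l.
Qed.

Lemma tensor_compatible : is_compatible (tensor_act M N) (tensor_coact M N).
Proof.
apply/is_compatibleP => a; apply: copower_ext => n.
rewrite -[LHS]kcompA tensor_actE copower_maplE [LHS]kcompA -[RHS]kcompA tensor_coactE.
move: (com_coact N n); apply: (tens_linear_ext
  (f := precomp (lact (rh_act M) a) \o twist (rh_coact M) (M ⊠ N) \o tmap (cin M N) idfun)
  (g := postcomp (diag_act (tensor_act M N) (ca_coact A a))
        \o twist (rh_coact M) (M ⊠ N) \o tmap (cin M N) idfun)) => {}n h.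
rewrite /= tmapE; apply: twist_lact; exact: cin_act_linear.
Qed.

Lemma tensor_rel_hopf_module : is_rel_hopf_module (tensor_act M N) (tensor_coact M N).
Proof.
split; [exact: tensor_module | exact: tensor_comodule | exact: tensor_compatible].
Qed.

(** Morphisms out of [M ⊠ N] are determined on the maps [cin M N n : m |-> m ⊗ n]. These are
    A-linear, and their coaction is given by [tensor_coactE]; naturality of [twist] then moves [g]
    inside. *)
Lemma tensor_morphismP (P : rel_hopf_module S A) objP (g : khom (M ⊠ N) P) :
  is_rel_hopf_morphism (M := @tensor_ob k S H A M objP N) (P := P) g <->
  forall n, act_linear (rh_act M) (rh_act P) (g ∘ cin M N n) /\
    rh_coact P ∘ (g ∘ cin M N n) =
    twist (rh_coact M) P (tmap (postcomp g \o cin M N) idfun (com_coact N n)).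
Proof.
have eact a n : g ∘ lact (tensor_act M N) a ∘ cin M N n = g ∘ cin M N n ∘ lact (rh_act M) a.
  by rewrite -kcompA tensor_actE copower_maplE kcompA.
have ecoact n : copower_mapl g H ∘ tensor_coact M N ∘ cin M N n =
    twist (rh_coact M) P (tmap (postcomp g \o cin M N) idfun (com_coact N n)).
  rewrite -kcompA tensor_coactE twist_nat tmap_tmap.
  by congr (twist _ _ _); apply: eq_tmap.
split=> [[/act_linearP lin col] n | gP].
  split; first by apply/act_linearP => a; rewrite -eact lin kcompA.
  by rewrite kcompA col ecoact.
split; first apply/act_linearP => a; apply: copower_ext => n.
  rewrite eact -[RHS]kcompA; exact: (act_linearP _ _ _).1 (gP n).1 a.
by rewrite -[LHS]kcompA (gP n).2 ecoact.
Qed.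

End TensorObject.

End RelHopf.

Section InternalHom.
Variables (k : fieldType) (S : grothcat k) (H : hopf_algebra k) (A : comodule_algebra H).
Variables (M P : rel_hopf_module S A).

Lemma copower_mapl_linear V : linear (fun f : khom M P => copower_mapl f V).
Proof.
by move=> a f f'; apply: copower_ext => v; rewrite kcompDl !copower_maplE kcompDr.
Qed.

Let C := cofree H (khom M P).
Let eval : {linear C -> khom M P} := @cofree_eval k H (khom M P).

(** The two conditions of [tensor_morphismP], written as differences and paired so that
    [largest_subcomodule] applies once. For [t = phi(n_0) ⊗ n_1], [eval t] is [phi(n)]. *)
Definition hom_defect (t : C) : (khom M (P ⊠ H) * khom (M ⊠ A) P)%type :=
  (rh_coact P ∘ eval t - twist (rh_coact M) P t,
   eval t ∘ rh_act M - rh_act P ∘ copower_mapl (eval t) A).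

Lemma hom_defect_linear : linear hom_defect.
Proof.
pose l1 : {linear C -> _} := (postcomp (rh_coact P) \o eval) \- twist (rh_coact M) P.
pose l2 : {linear C -> _} := (precomp (rh_act M) \o eval) \-
  (postcomp (rh_act P) \o linear_of (copower_mapl_linear A) \o eval).
move=> a t t'; congr pair; [exact: (linearP l1) | exact: (linearP l2)].
Qed.

Lemma hom_defect0 t : hom_defect t = 0 <->
  act_linear (rh_act M) (rh_act P) (eval t) /\
  rh_coact P ∘ eval t = twist (rh_coact M) P t.
Proof.
rewrite /hom_defect; split=> [[/eqP e1 /eqP e2] | [e2 e1]].
  by move: e1 e2; rewrite !subr_eq0 => /eqP e1 /eqP e2.
by rewrite e1 e2 !subrr.
Qed.

Lemma internal_hom_universal objP :
  exists (K : comodule H) (e : rel_hopf_hom (@tensor_ob k S H A M objP K) P),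
  forall (N : comodule H) (g : rel_hopf_hom (tensor_ob objP N) P),
    exists! h : comod_hom N K, sval e ∘ copower_map M (sval h) = sval g.
Proof.
have [K [i [iinj il iU]]] := largest_subcomodule (linear_of hom_defect_linear).
pose phi : {linear K -> khom M P} := eval \o sval i.
pose e : khom (M ⊠ K) P := cdesc phi.
have eP : is_rel_hopf_morphism (M := tensor_ob objP K) (P := P) e.
  apply/tensor_morphismP => n; rewrite cdescE.
  have /hom_defect0 [lin col] := il n; split; first exact: lin.
  rewrite [LHS]col; congr (twist _ _ _).
  (* Colinearity of [i] gives [i(n) = phi(n_0) ⊗ n_1], the argument that [tensor_morphismP]
     expects. *)
  rewrite -[LHS](coextend_eval (svalP i)); apply: eq_tmap => // m.
  exact/esym/cdescE.
exists K, (exist _ e eP) => N [g gP]; rewrite [sval _]/=.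
pose psi := coextend (postcomp g \o cin M N).
have evalpsi n : eval (psi n) = g ∘ cin M N n by exact: cofree_eval_coextend.
have psi0 n : hom_defect (psi n) = 0.
  by apply/hom_defect0; rewrite evalpsi; apply: (tensor_morphismP _ _).1 gP n.
have [h hE] := iU N (exist _ psi (coextend_colinear _)) psi0.
exists h; split=> [|h' /= h'E].
  apply: copower_ext => n; rewrite -kcompA copower_mapE cdescE /= hE.
  exact: evalpsi.
apply/comod_hom_ext/linear_ext => n; apply: iinj; rewrite hE /=.
(* Uniqueness: the colinear map [i h'] is the coextension of its composite with [eval], which is
   forced to be [n |-> g ∘ cin M N n]; and [i] is injective. *)
have ih'col : is_colinear (vect_comp (sval i) (sval h')).
  by apply: comod_comp_subproof.
rewrite -[RHS](coextend_eval ih'col); apply: eq_tmap => // m.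
by rewrite /= /postcomp -h'E -kcompA copower_mapE cdescE.
Qed.

End InternalHom.

(** * The adjunction *)

Theorem proposition5p1 (k : fieldType) (S : grothcat k) (H : hopf_algebra k)
    (A : comodule_algebra H) (M : rel_hopf_module S A) :
  exists (objP : forall N : comodule H,
            is_rel_hopf_module (tensor_act M N) (tensor_coact M N))
         (morP : forall (N N' : comodule H) (f : comod_hom N N'),
            is_rel_hopf_morphism (M := tensor_ob objP N) (P := tensor_ob objP N')
              (copower_map M (sval f)))
         (HOM : functor (RelHopf S A) (Com H)),
    inhabited (adjunction (tensor_functor morP) HOM).
Proof.
have objP := tensor_rel_hopf_module M; exists objP.
have morP N N' (f : comod_hom N N') :
    is_rel_hopf_morphism (M := tensor_ob objP N) (P := tensor_ob objP N')
      (copower_map M (sval f)).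
  apply/tensor_morphismP => n; rewrite copower_mapE; split; first exact: cin_act_linear.
  rewrite [LHS]tensor_coactE (svalP f) tmap_tmap; congr (twist _ _ _).
  by apply: eq_tmap => // m; rewrite /= /postcomp copower_mapE.
exists morP; apply: right_adjoint_of_universal => P.
have [K [e eU]] := internal_hom_universal P objP.
exists K, e => N g; have [h [hE hU]] := eU N g.
exists h; split; first exact: rel_hopf_hom_ext.
by move=> h' h'E; apply: hU; rewrite -h'E.
Qed.
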